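(* Let $D$ be an arc-locally out-semicomplete digraph. If $D$ does not contain a blocking odd cycle as an induced subdigraph, then $D$ is BE-diperfect.
   Context: All digraphs are finite, without loops and without multiple edges (a pair of opposite edges $uv$, $vu$ is allowed). Two vertices $u,v$ are adjacent if $uv$ or $vu$ is an edge. The underlying graph $U(D)$ is the simple graph on $V(D)$ in which two vertices are joined exactly when they are adjacent in $D$. A source is a vertex with no in-neighbor, a sink is a vertex with no out-neighbor. A digraph $D$ is arc-locally out-semicomplete if for each edge $uv\in E(D)$, every out-neighbor of $u$ and every out-neighbor of $v$ are adjacent or are the same vertex. A digraph $C$ is a blocking odd cycle if $U(C)=x_1x_2\dots x_{2k+1}x_1$ is a cycle for some $k\ge 1$, $x_1$ is a source of $C$ and $x_2$ is a sink of $C$. A stable set is a set of pairwise non-adjacent vertices. A path is a directed path with distinct vertices (a single vertex is a path). A path partition of $D$ is a collection $\mathcal{P}$ of paths of $D$ such that every vertex of $D$ belongs to exactly one path of $\mathcal{P}$. For a stable set $S$ of $D$, an $S_{BE}$-path partition of $D$ is a path partition $\mathcal{P}$ such that $|V(P)\cap S|=1$ for every $P\in\mathcal{P}$ and every vertex of $S$ starts or ends a path of $\mathcal{P}$. A digraph satisfies the BE-property if for every maximum (i.e. maximum cardinality) stable set $S$ it has an $S_{BE}$-path partition. A digraph is BE-diperfect if every one of its induced subdigraphs satisfies the BE-property. *)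

(* Defs.v *)
(* A digraph is an irreflexive [e : rel T] on a finType [T]:
   [e u v] means that uv is an edge, and opposite edges are allowed. *)
From mathcomp Require Import all_boot.

Set Implicit Arguments.
Unset Strict Implicit.
Unset Printing Implicit Defensive.

Section Digraph.
Variables (T : finType) (e : rel T).

(* This is also the edge relation of the underlying graph U(D). *)
Definition adjacent : rel T := fun u v => e u v || e v u.

Definition source (v : T) : Prop := forall u, ~~ e u v.

Definition sink (v : T) : Prop := forall u, ~~ e v u.

Definition arc_locally_out_semicomplete : Prop :=
  forall u v x y : T, e u v -> e u x -> e v y -> adjacent x y \/ x = y.

(* [x] lists the vertices of the cycle, [x i] being x_(i+1), and [ordS] is the
   cyclic successor.  All edges of the underlying graph are edges of the
   cycle, and conversely. *)
Definition blocking_odd_cycle : Prop :=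
  exists (k : nat) (x : 'I_(k.*2.+1) -> T),
    [/\ 1 <= k,
        bijective x,
        forall i j, adjacent (x i) (x j) = (j == ordS i) || (i == ordS j),
        source (x ord0)
      & sink (x (ordS ord0))].

Definition stable (S : {set T}) : Prop := {in S &, forall u v, ~~ adjacent u v}.

Definition maximum_stable (S : {set T}) : Prop :=
  stable S /\ forall S' : {set T}, stable S' -> #|S'| <= #|S|.

(* A path is given by the nonempty sequence of its vertices. *)
Definition dipath (p : seq T) : bool :=
  if p is x :: q then path e x q && uniq p else false.

Definition starts_or_ends (v : T) (p : seq T) : bool :=
  if p is x :: q then (v == x) || (v == last x q) else false.

Definition path_partition (P : seq (seq T)) : Prop :=
  {in P, forall p, dipath p} /\
  forall v : T, count (fun p : seq T => v \in p) P = 1.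

Definition BE_path_partition (S : {set T}) (P : seq (seq T)) : Prop :=
  [/\ path_partition P,
      {in P, forall p : seq T, #|[set v in p] :&: S| = 1}
    & {in S, forall v, exists2 p, p \in P & starts_or_ends v p}].

Definition BE_property : Prop :=
  forall S : {set T}, maximum_stable S -> exists P, BE_path_partition S P.

End Digraph.

Definition induced (T : finType) (e : rel T) (A : {set T}) :
    rel {v : T | v \in A} :=
  fun u v => e (val u) (val v).
Arguments induced {T} e A.

Definition BE_diperfect (T : finType) (e : rel T) : Prop :=
  forall A : {set T}, BE_property (induced e A).

Definition contains_induced_blocking_odd_cycle (T : finType) (e : rel T) :
    Prop :=
  exists A : {set T}, blocking_odd_cycle (induced e A).

(* Main.v *)
(* Call a vertex set indecomposable if the stability number alpha is strictly
   subadditive over each of its proper bipartitions.  Every vertex set splits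
   into indecomposable pieces over which alpha is additive, so a maximum stable
   set is maximum in each piece and path partitions of the pieces can be united.
   The point is that an indecomposable set V is a clique or an induced directed
   cycle, both of which are easy to partition.

   Suppose that V is not a clique.  Then |X| < |N(X)| for every nonempty stable X
   in V; in particular V is not bipartite.  Let v -> x -> y with y <> v.  The
   out-neighbours of v are complete to their own out-neighbours; if all
   in-neighbours of v lay within distance 2 from v, then N(v) would be contained
   in a join, and gluing clique pieces from the two sides of the join would give
   a clique meeting all maximum stable sets.  So v has a "remote" in-neighbour,
   at distance at least 3 from v, and going backwards one finds a closed walk b
   of remote edges from which v is reachable.  A vertex reached from b in k steps
   is adjacent to b_{k-1} and b_{k+1} but not to b_k; so if no vertex is reached
   in both an even and an odd number of steps, there is no closed odd walk, and V
   is bipartite.  Otherwise V is a blow-up of a directed odd cycle of length at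
   least 5, and comparing maximum stable sets shows that each class of the
   blow-up is a single vertex. *)
Require Import Defs.
From mathcomp Require Import all_boot zify.

Set Implicit Arguments.
Unset Strict Implicit.
Unset Printing Implicit Defensive.

(** * Stability number *)

Section StabilityNumber.
Variables (T : finType) (a : rel T).
Implicit Types (B K S V W X : {set T}).

Definition stableb S := [forall u in S, forall v in S, ~~ a u v].

Lemma stablebP S : reflect {in S &, forall u v, ~~ a u v} (stableb S).
Proof.
apply: (iffP forall_inP) => [H u v uS vS | H u uS].
  by have /forall_inP := H u uS; apply.
by apply/forall_inP => v vS; apply: H.
Qed.

Lemma stableb_sub S W : W \subset S -> stableb S -> stableb W.
Proof.
move=> /subsetP WS /stablebP stS; apply/stablebP => u v uW vW.
by apply: stS; apply: WS.
Qed.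

Definition clique S := {in S &, forall u v, (u == v) || a u v}.

Definition alpha V := \max_(S : {set T} | stableb S && (S \subset V)) #|S|.

Lemma leq_alpha V S : stableb S -> S \subset V -> #|S| <= alpha V.
Proof.
by move=> stS SV; apply: (leq_bigmax_cond (F := fun S => #|S|)); rewrite stS.
Qed.

Lemma alpha_leP V n :
  reflect (forall S, stableb S -> S \subset V -> #|S| <= n) (alpha V <= n).
Proof.
apply: (iffP (bigmax_leqP _ _ _)) => H S; last by case/andP; apply: H.
by move=> stS SV; apply: H; rewrite stS.
Qed.

Lemma alpha_witness V :
  exists S, [/\ stableb S, S \subset V & #|S| = alpha V].
Proof.
have H0 : stableb set0 && (set0 \subset V).
  by rewrite sub0set andbT; apply/stablebP => u v; rewrite inE.
exists [arg max_(S > set0 | stableb S && (S \subset V)) #|S|].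
case: arg_maxnP => // S /andP[stS SV] maxS; split=> //.
apply/eqP; rewrite eqn_leq leq_alpha //=; apply/alpha_leP => S' stS' S'V.
by apply: maxS; rewrite stS'.
Qed.

Lemma alpha_clique K : clique K -> alpha K <= 1.
Proof.
move=> clK; apply/alpha_leP => S /stablebP stS /subsetP SK.
rewrite leqNgt; apply/negP => /card_gt1P[x [y [xS yS xy]]].
by have := clK x y (SK _ xS) (SK _ yS); rewrite (negPf xy) (negPf (stS _ _ xS yS)).
Qed.

Lemma alpha_setU V W : alpha (V :|: W) <= alpha V + alpha W.
Proof.
apply/alpha_leP => S stS SVW.
rewrite -(cardsID V S); apply: leq_add; apply: leq_alpha.
- exact: stableb_sub (subsetIl _ _) stS.
- exact: subsetIr.
- exact: stableb_sub (subsetDl _ _) stS.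
- by rewrite subDset.
Qed.

(* [indecomposable] sets are the pieces of a finest partition of the vertex set
   on which the stability number is additive. *)
Definition indecomposable V :=
  V != set0 /\ forall W, W \subset V -> W != set0 -> W != V ->
    alpha V < alpha W + alpha (V :\: W).

(** A smallest set through [v] that splits off additively is indecomposable: if it split further,
    the part containing [v] would be smaller. *)
Lemma exists_indecomposable V v : v \in V ->
  exists B, [/\ v \in B, B \subset V, indecomposable B
              & alpha B + alpha (V :\: B) <= alpha V].
Proof.
move=> vV.
pose P B := [&& v \in B, B \subset V & alpha B + alpha (V :\: B) <= alpha V].
have PV : P V.
  rewrite /P vV subxx setDv /= -[leqRHS]addn0 leq_add2l.
  by apply/alpha_leP => S _; rewrite subset0 => /eqP->; rewrite cards0.
have [B /and3P[vB BV leB] minB] := arg_minnP (fun B => #|B|) PV.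
exists B; split=> //; split; first by apply/set0Pn; exists v.
have piece W : v \in W -> W \subset B -> W != B ->
    alpha B < alpha W + alpha (B :\: W).
  move=> vW WB neqWB; rewrite ltnNge; apply/negP => leW.
  have /minB : P W.
    rewrite /P vW (subset_trans WB BV) /=; apply: leq_trans leB.
    apply: leq_trans (_ : alpha W + (alpha (B :\: W) + alpha (V :\: B)) <= _).
      rewrite leq_add2l (leq_trans _ (alpha_setU _ _)) //.
      apply/alpha_leP => S stS SVW; apply: leq_alpha => //.
      apply: subset_trans SVW _; apply/subsetP => x; rewrite !inE.
      by case: (x \in W) (x \in B) (x \in V) => [] [] [].
    by rewrite addnA leq_add2r.
  by rewrite leqNgt proper_card // properEneq neqWB.
move=> W WB W0 neqWB; have [vW|vNW] := boolP (v \in W); first exact: piece.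
have eqW : B :\: (B :\: W) = W by rewrite setDDr setDv set0U; apply/setIidPr.
rewrite addnC -{2}eqW; apply: piece; rewrite ?subsetDl //.
  by rewrite inE vNW vB.
apply: contraNneq W0 => /setDidPl BW.
by rewrite -(setIidPr WB) setI_eq0.
Qed.

Definition neighbours V X := [set y in V | [exists x in X, a x y]].

Hypotheses (a_sym : symmetric a) (a_irr : irreflexive a).

Lemma neighboursP V X y :
  reflect (y \in V /\ exists2 x, x \in X & a x y) (y \in neighbours V X).
Proof.
by rewrite inE; apply: (iffP andP) => -[yV] /exists_inP.
Qed.

(* In a smallest counterexample [X] the proper nonempty subsets expand; hence, for
   an edge [xh] between [X] and its neighbourhood, every stable set avoiding [x]
   and [h] can be enlarged by swapping in [X]. *)
Lemma indecomposable_expand V X : indecomposable V -> ~ clique V ->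
  X \subset V -> X != set0 -> stableb X -> #|X| < #|neighbours V X|.
Proof.
move=> [V0 indV] nclV XV X0 stX; rewrite ltnNge; apply/negP => leX.
pose P X := [&& X \subset V, X != set0, stableb X & #|neighbours V X| <= #|X|].
have PX : P X by rewrite /P XV X0 stX.
have [{leX X0 stX PX}X /and4P[{}XV X0 stX leX] minX] :=
  arg_minnP (fun X => #|X|) PX.
have [x xX] := set0Pn _ X0; have xV := subsetP XV x xX.
(* A clique meeting every maximum stable set would split off additively, since its [alpha] is at
   most 1. *)
have decomp K : x \in K -> K \subset V -> clique K ->
    ~ (alpha (V :\: K) < alpha V).
  move=> xK KV clK lt_alpha; have K0 : K != set0 by apply/set0Pn; exists x.
  have [eqKV|neqKV] := eqVneq K V; first by apply: nclV; rewrite -eqKV.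
  have := indV K KV K0 neqKV; have := alpha_clique clK.
  by move: lt_alpha; clear; lia.
have [Nx0|/set0Pn[h]] := eqVneq (neighbours V [set x]) set0.
  apply: (decomp [set x]); rewrite ?set11 ?sub1set //.
    by move=> u v; rewrite !inE => /eqP-> /eqP->; rewrite eqxx.
  have [S [stS SV <-]] := alpha_witness (V :\: [set x]).
  have xNS : x \notin S by apply/negP => /(subsetP SV); rewrite !inE eqxx.
  have := cardsU1 x S; rewrite xNS add1n => <-; apply: leq_alpha; last first.
    by rewrite subUset sub1set xV (subset_trans SV (subsetDl _ _)).
  have xN z : z \in S -> ~~ a x z.
    move=> zS; apply/negP => axz.
    have : z \in neighbours V [set x].
      apply/neighboursP; split; last by exists x; rewrite ?set11.
      by have /setDP[] := subsetP SV z zS.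
    by rewrite Nx0 inE.
  apply/stablebP => u v; rewrite !in_setU1.
  case/predU1P => [->|uS] /predU1P[->|vS]; rewrite ?a_irr ?xN //.
    by rewrite a_sym xN.
  by move/stablebP: stS; apply.
case/neighboursP => hV [_ /set1P-> axh].
have hN : h \in neighbours V X by apply/neighboursP; split=> //; exists x.
apply: (decomp [set x; h]); rewrite ?in_set2 ?eqxx ?subUset ?sub1set ?xV ?hV //.
  move=> u v /set2P[]-> /set2P[]->; rewrite ?eqxx ?axh ?orbT //.
  by rewrite a_sym axh orbT.
have [S [stS SV <-]] := alpha_witness (V :\: [set x; h]).
have SinV z : z \in S -> z \in V by move=> /(subsetP SV)/setDP[].
have xNS : x \notin S by apply/negP => /(subsetP SV); rewrite !inE eqxx.
have hNS : h \notin S by apply/negP => /(subsetP SV); rewrite !inE eqxx orbT.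
set N := neighbours V X in leX hN.
(* If [S] meets [X], the neighbours of [S :&: X] outnumber it, lie in [N] and avoid [S]; otherwise
   [S] still misses [h] in [N]. *)
have ltS : #|S :&: (X :|: N)| < #|X|.
  have leU : #|S :&: (X :|: N)| <= #|S :&: X| + #|S :&: N|.
    by rewrite setIUr cardsU leq_subr.
  have [SX0|SX0] := eqVneq (S :&: X) set0.
    have : #|S :&: N| < #|N|.
      apply: proper_card; rewrite properE subsetIr /=.
      by apply/subsetPn; exists h => //; rewrite inE (negPf hNS).
    by move: leU leX; rewrite SX0 cards0; clear; lia.
  have ltSX : #|S :&: X| < #|X|.
    apply: proper_card; rewrite properE subsetIr /=.
    by apply/subsetPn; exists x => //; rewrite inE (negPf xNS).
  have expSX : #|S :&: X| < #|neighbours V (S :&: X)|.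
    rewrite ltnNge; apply/negP => leSX; move: ltSX; rewrite ltnNge minX //.
    rewrite /P SX0 leSX (stableb_sub (subsetIr _ _) stX) !andbT.
    exact: subset_trans (subsetIr _ _) XV.
  have dis : neighbours V (S :&: X) :&: (S :&: N) = set0.
    apply/setP => y; rewrite [RHS]inE; apply/negP.
    case/setIP => /neighboursP[yV [z /setIP[zS zX] azy]] /setIP[yS _].
    by move/stablebP: stS => /(_ z y zS yS); rewrite azy.
  have : #|neighbours V (S :&: X) :|: (S :&: N)| <= #|N|.
    apply: subset_leq_card; rewrite subUset subsetIr andbT.
    apply/subsetP => y /neighboursP[yV [z /setIP[zS zX] azy]].
    by apply/neighboursP; split=> //; exists z.
  have := cardsUI (neighbours V (S :&: X)) (S :&: N).
  by rewrite dis cards0; move: leU leX expSX; clear; lia.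
rewrite -(cardsID (X :|: N) S).
suff : #|S :\: (X :|: N)| + #|X| <= alpha V by move: ltS; clear; lia.
have dis : (S :\: (X :|: N)) :&: X = set0.
  by apply/setP => y; rewrite !inE; case: (y \in X); rewrite ?andbF.
rewrite -cardsUI dis cards0 addn0; apply: leq_alpha; last first.
  by rewrite subUset XV andbT; apply/subsetP => y /setDP[/SinV].
have far y z : y \in S :\: (X :|: N) -> z \in X -> ~~ a z y.
  case/setDP => yS; rewrite inE negb_or => /andP[_ yN] zX; apply: contra yN => azy.
  by apply/neighboursP; split; [apply: SinV | exists z].
apply/stablebP => u v /setUP[uS|uX] /setUP[vS|vX].
- by move/stablebP: stS; apply; [case/setDP: uS | case/setDP: vS].
- by rewrite a_sym far.
- by rewrite far.
- by move/stablebP: stX; apply.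
Qed.

(** A nonempty class has its neighbours in the other one, so expansion makes it strictly smaller;
    this cannot hold both ways. *)
Lemma indecomposable_not_bipartite V P Q : indecomposable V -> ~ clique V ->
  P :|: Q = V -> stableb P -> stableb Q -> False.
Proof.
move=> indV nclV PQ stP stQ.
have exp A B : A :|: B = V -> stableb A -> A != set0 -> #|A| < #|B|.
  move=> AB stA A0.
  have AV : A \subset V by rewrite -AB subsetUl.
  apply: leq_trans (indecomposable_expand indV nclV AV A0 stA) _.
  apply: subset_leq_card; apply/subsetP => y /neighboursP[].
  rewrite -AB => /setUP[yA [x xA axy]|//].
  by move/stablebP: stA => /(_ x y xA yA); rewrite axy.
have exP := exp _ _ PQ stP; have exQ := exp Q P; rewrite setUC in exQ.
have [P0|/exP ltPQ] := eqVneq P set0; last first.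
  suff /(exQ PQ stQ) : Q != set0 by rewrite ltnNge ltnW.
  by rewrite -card_gt0 (leq_ltn_trans _ ltPQ).
have : #|Q| < #|P|.
  apply: exQ => //; apply: contraPneq indV => Q0 [].
  by rewrite -PQ P0 Q0 setU0 eqxx.
by rewrite P0 cards0.
Qed.

(** Without edges across, stable sets of [W] and [V :\: W] unite, so [alpha] would be additive over
    a proper split. *)
Lemma indecomposable_connected V W : indecomposable V -> W \subset V ->
  W != set0 -> {in W & V :\: W, forall x y, ~~ a x y} -> W = V.
Proof.
move=> [_ indV] WV W0 sepW; have [//|neqWV] := eqVneq W V.
have := indV W WV W0 neqWV; rewrite ltnNge => /negP[].
have [S [stS SW <-]] := alpha_witness W.
have [S' [stS' S'W <-]] := alpha_witness (V :\: W).
rewrite -cardsUI (_ : S :&: S' = set0); last first.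
  apply/setP => x; rewrite !inE; apply/negP => /andP[/(subsetP SW) xW].
  by move/(subsetP S'W); rewrite inE xW.
rewrite cards0 addn0; apply: leq_alpha; last first.
  by rewrite subUset (subset_trans SW WV) (subset_trans S'W (subsetDl _ _)).
apply/stablebP => u v /setUP[uS|uS] /setUP[vS|vS].
- by move/stablebP: stS; apply.
- by apply: sepW; [apply: subsetP uS | apply: subsetP vS].
- by rewrite a_sym; apply: sepW; [apply: subsetP vS | apply: subsetP uS].
- by move/stablebP: stS'; apply.
Qed.

(* The clique pieces through [v] obtained by deleting either side of the join glue
   to a clique, which meets every maximum stable set because such a set misses
   one of the sides. *)
Lemma indecomposable_join V V1 V2 v : indecomposable V -> v \in V ->
    v \notin V1 :|: V2 -> V1 \subset V -> V2 \subset V ->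
    V1 != set0 -> V2 != set0 -> [disjoint V1 & V2] ->
    {in V1 & V2, forall x y, a x y} ->
    {in V, forall y, a v y -> y \in V1 :|: V2} ->
    (forall B, B \subset V -> B != V -> v \in B -> indecomposable B -> clique B) ->
  clique V.
Proof.
move=> [_ indV] vV vN12 V1V V2V V10 V20 dis12 join12 nbr_v IH.
have [vN1 vN2] : v \notin V1 /\ v \notin V2 by apply/norP; rewrite -in_setU.
have piece W W' : W \subset V -> W != set0 -> v \notin W -> W :|: W' = V1 :|: V2 ->
    exists B, [/\ v \in B, B \subset v |: W', clique B &
                  alpha ((V :\: W) :\: B) < alpha V].
  move=> WV /set0Pn[w wW] vNW defW.
  have vW : v \in V :\: W by rewrite inE vNW.
  have [B [vB BW indB leB]] := exists_indecomposable vW.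
  have BV := subset_trans BW (subsetDl V W).
  have neqB : B != V.
    apply: contraTneq wW => eqB; have := subsetP WV w; rewrite -eqB => H.
    by apply/negP => wW; have := subsetP BW _ (H wW); rewrite inE wW.
  have clB := IH B BV neqB vB indB.
  exists B; split=> //.
    apply/subsetP => y yB; rewrite in_setU1 -implyNb; apply/implyP => yv.
    have := clB v y vB yB; rewrite eq_sym (negPf yv) /= => avy.
    have := nbr_v y (subsetP BV y yB) avy; rewrite -defW => /setUP[yW|//].
    by have := subsetP BW y yB; rewrite inE yW.
  have : 0 < alpha B.
    apply: leq_trans (_ : #|[set v]| <= _); first by rewrite cards1.
    apply: leq_alpha; last by rewrite sub1set.
    by apply/stablebP => u w' /set1P-> /set1P->; rewrite a_irr.
  have : alpha (V :\: W) <= alpha V.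
    apply/alpha_leP => S stS SW; apply: leq_alpha => //.
    exact: subset_trans SW (subsetDl _ _).
  by move: leB; clear; lia.
have [B1 [vB1 B1sub clB1 ltB1]] := piece V2 V1 V2V V20 vN2 (setUC _ _).
have [B2 [vB2 B2sub clB2 ltB2]] := piece V1 V2 V1V V10 vN1 (erefl _).
pose K := B1 :|: B2.
have clK : clique K.
  have cross x y : x \in B1 -> y \in B2 -> (x == y) || a x y.
    move=> xB yB; case/setU1P: (subsetP B1sub x xB) => [->|x1].
      exact: clB2.
    case/setU1P: (subsetP B2sub y yB) => [->|y2]; first exact: clB1.
    by rewrite join12 ?orbT.
  move=> x y /setUP[xB|xB] /setUP[yB|yB]; [exact: clB1|exact: cross| |exact: clB2].
  by rewrite eq_sym a_sym cross.
have KV : K \subset V.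
  rewrite subUset (subset_trans B1sub) ?(subset_trans B2sub) //.
    by rewrite subUset sub1set vV.
  by rewrite subUset sub1set vV.
have [<-//|neqKV] := eqVneq K V.
have K0 : K != set0 by apply/set0Pn; exists v; rewrite inE vB1.
have := indV K KV K0 neqKV; have le1 := alpha_clique clK.
suff ltK : alpha (V :\: K) < alpha V by move: le1 ltK; clear; lia.
have [S [stS SVK <-]] := alpha_witness (V :\: K).
have side W B : B \subset K -> S :&: W = set0 -> S \subset (V :\: W) :\: B.
  move=> /subsetP BK SW0; apply/subsetP => x xS.
  have /setDP[xV xK] := subsetP SVK x xS.
  rewrite !inE xV andbT; apply/andP; split; first by apply: contra xK; apply: BK.
  by apply/negP => xW; have := in_set0 x; rewrite -SW0 inE xS xW.
have [S20|/set0Pn[y /setIP[yS y2]]] := eqVneq (S :&: V2) set0.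
  apply: leq_ltn_trans ltB1; apply: leq_alpha => //.
  exact: side (subsetUl _ _) S20.
apply: leq_ltn_trans ltB2; apply: leq_alpha => //; apply: side (subsetUr _ _) _.
apply/eqP/negPn/negP => /set0Pn[x /setIP[xS x1]].
by move/stablebP: stS => /(_ x y xS yS); rewrite join12.
Qed.

End StabilityNumber.

(** * Digraphs *)

Section DigraphBlocks.
Variables (T : finType) (e : rel T).
Implicit Types (B K S V W : {set T}) (p q : seq T).
Local Notation adj := (adjacent e).

Lemma adjacent_sym : symmetric adj.
Proof. by move=> x y; rewrite /adjacent orbC. Qed.

Lemma adjacent_irr : irreflexive e -> irreflexive adj.
Proof. by move=> irr x; rewrite /adjacent irr. Qed.

(** A violating triple induces a blocking odd cycle on three vertices, with source [x] and sink
    [z]. *)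
Definition no_transitive_triangle :=
  forall x y z, e x y -> e y z -> e x z -> [|| e y x, e z y | e z x].

(* [s] is the successor function; such a set is a disjoint union of induced
   directed cycles of length at least 4. *)
Definition directed_hole B := exists s : T -> T,
  [/\ {in B, forall x, s x \in B},
      {in B &, forall x y, e x y = (y == s x)},
      {in B &, injective s},
      {in B, forall y, exists2 x, x \in B & y = s x}
    & {in B, forall x, (s (s x) != x) && (s (s (s x)) != x)}].

Hypotheses (e_irr : irreflexive e) (e_alos : arc_locally_out_semicomplete e).

(** Otherwise all neighbours of [v] lie in [A1 :|: A2], the vertices reached in one or two steps.
    Arc-locality makes [A1] complete to [A2], and [indecomposable_join] turns [V] into a clique. *)
Lemma exists_remote_in_neighbour V v x y :
    indecomposable adj V -> ~ clique adj V ->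
    (forall B, B \subset V -> B != V -> indecomposable adj B ->
      clique adj B \/ directed_hole B) ->
    v \in V -> x \in V -> y \in V -> e v x -> e x y -> y != v ->
  exists w, [/\ w \in V, e w v, ~~ e v w
              & forall z, z \in V -> e v z -> ~~ e z w].
Proof.
move=> indV nclV IH vV xV yV vx xy yv.
have [/exists_inP[w wV /and3P[wv vw /forall_inP far]]|] := boolP
  [exists w in V, [&& e w v, ~~ e v w & [forall z in V, e v z ==> ~~ e z w]]].
  exists w; split=> // z zV vz; exact: implyP (far z zV) vz.
move=> /exists_inPn near; case: nclV.
have {}near w : w \in V -> e w v -> ~~ e v w ->
    exists z, [/\ z \in V, e v z & e z w].
  move=> wV wv vw; have := near w wV; rewrite wv vw /=.
  by case/forall_inPn => z zV; rewrite negb_imply negbK => /andP[]; exists z.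
pose A1 := [set z in V | e v z].
pose A2 := [set z in V | (z != v) && [exists t in A1, e t z]].
have vA : v \notin A1 :|: A2 by rewrite !inE e_irr eqxx vV.
have nbrA : {in V, forall z, adj v z -> z \in A1 :|: A2}.
  move=> z zV; have [vz _|nvz] := boolP (e v z); first by rewrite !inE zV vz.
  rewrite /adjacent (negPf nvz) /= => zv.
  have [t [tV vt tz]] := near z zV zv nvz.
  rewrite !inE zV (negPf nvz) /=; apply/andP; split.
    by apply: contraNneq nvz => zv'; move: zv; rewrite zv' e_irr.
  by apply/exists_inP; exists t; rewrite // inE tV.
have joinA z t : z \in A1 -> t \in A2 -> z != t -> adj z t.
  rewrite !inE => /andP[zV vz] /and3P[tV _ /exists_inP[r]].
  rewrite inE => /andP[rV vr] rt zt.
  by case: (e_alos vr vz rt) => // eqzt; rewrite eqzt eqxx in zt.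
have A1V : A1 \subset V by apply/subsetP => z; rewrite inE => /andP[].
have A2V : A2 \subset V by apply/subsetP => z; rewrite inE => /andP[].
(* In a hole, the predecessor [p] of [v] would be reached from [v] in two steps, and arc-locality
   would make it adjacent or equal to [s v]. *)
have clB B : B \subset V -> B != V -> v \in B -> indecomposable adj B ->
    clique adj B.
  move=> BV neqB vB /(IH B BV neqB)[//|[s [sB es s_inj pred far]]].
  have [p pB defv] := pred v vB; case/andP: (far p pB) => ssp sssp.
  have pv : e p v by rewrite es // defv.
  have [] := near p (subsetP BV p pB) pv.
    by rewrite es // defv eq_sym.
  move=> z [zV vz zp].
  have svB := sB v vB; have vsv : e v (s v) by rewrite es.
  case: (e_alos vz vsv zp) => [|svp].
    rewrite /adjacent !es // => /orP[/eqP psv|/eqP svv].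
      by move: sssp; rewrite -defv -psv eqxx.
    by move: vsv; rewrite svv -defv e_irr.
  by move: ssp; rewrite -defv svp eqxx.
have finish V1 V2 : V1 :|: V2 = A1 :|: A2 -> V1 != set0 -> V2 != set0 ->
    [disjoint V1 & V2] -> {in V1 & V2, forall z t, adj z t} -> clique adj V.
  move=> defA V10 V20 dis12 join12.
  have /andP[sub1 sub2] : (V1 \subset V) && (V2 \subset V).
    by rewrite -subUset defA subUset A1V.
  apply: (indecomposable_join adjacent_sym (adjacent_irr e_irr) indV vV _
    sub1 sub2 V10 V20 dis12 join12); rewrite ?defA //.
have [A120|/set0Pn[b /setIP[bA1 bA2]]] := eqVneq (A1 :&: A2) set0.
  apply: (finish A1 A2) => //.
  - by apply/set0Pn; exists x; rewrite inE xV.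
  - apply/set0Pn; exists y; rewrite inE yV yv /=.
    by apply/exists_inP; exists x; rewrite // inE xV.
  - by rewrite -setI_eq0 A120.
  move=> z t zA1 tA2; apply: joinA => //; apply: contraPneq A120 => zt.
  by apply/eqP/set0Pn; exists z; rewrite inE zA1 zt.
(* Being in both sets, [b] is adjacent to all their other vertices and forms one side of the join
   alone. *)
apply: (finish [set b] ((A1 :|: A2) :\ b)).
- by rewrite setD1K // inE bA1.
- by apply/set0Pn; exists b; rewrite set11.
- move: bA2; rewrite inE => /and3P[bV _ /exists_inP[r rA1 rb]].
  apply/set0Pn; exists r; rewrite !inE in rA1 *; rewrite rA1 /= andbT.
  by apply: contraTneq rb => ->; rewrite e_irr.
- by rewrite disjoints1 !inE eqxx.
move=> _ t /set1P-> /setD1P[tb /setUP[tA|tA]]; last by rewrite joinA 1?eq_sym.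
by rewrite adjacent_sym joinA.
Qed.

End DigraphBlocks.

(** * Walks of a given length *)

Fixpoint walk (T : finType) (r : rel T) k x y : bool :=
  if k is k'.+1 then [exists z, walk r k' x z && r z y] else x == y.
Arguments walk : simpl never.

Section Walks.
Variables (T : finType) (r : rel T).

Lemma walkS k x y z : walk r k x y -> r y z -> walk r k.+1 x z.
Proof. by move=> xy yz; apply/existsP; exists y; apply/andP. Qed.

Lemma walk1 x y : r x y -> walk r 1 x y.
Proof. by apply: walkS; apply/eqP. Qed.

Lemma walk_trans k l x y z : walk r k x y -> walk r l y z -> walk r (k + l) x z.
Proof.
move=> xy; elim: l z => [|l IH] z; first by move=> /eqP<-; rewrite addn0.
by case/existsP => t /andP[/IH xt tz]; rewrite addnS; apply: walkS xt tz.
Qed.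

Lemma walk_sym k x y : symmetric r -> walk r k x y = walk r k y x.
Proof.
move=> r_sym; suff rev l u v : walk r l u v -> walk r l v u.
  by apply/idP/idP; apply: rev.
elim: l u v => [|l IH] u v; first by rewrite /walk eq_sym.
case/existsP => z /andP[/IH zu zv]; rewrite -add1n.
by apply: walk_trans zu; apply: walk1; rewrite r_sym.
Qed.

Lemma walk_seq (x : nat -> T) i k :
  (forall j, j < k -> r (x (i + j)) (x (i + j).+1)) -> walk r k (x i) (x (i + k)).
Proof.
elim: k => [|k IH] stepx; first by rewrite addn0; apply/eqP.
by rewrite addnS; apply: walkS (stepx k _) => //; apply: IH => j /ltnW; apply: stepx.
Qed.

End Walks.

(** * Walks of remote edges *)

Section RemoteEdges.
Variables (T : finType) (e : rel T).
Hypotheses (e_irr : irreflexive e) (e_alos : arc_locally_out_semicomplete e).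
Hypothesis e_ntt : no_transitive_triangle e.
Local Notation adj := (adjacent e).

Lemma alos_neq u v x y : e u v -> e u x -> e v y -> x != y -> adj x y.
Proof.
by move=> uv ux vy xy; case: (e_alos uv ux vy) xy => // ->; rewrite eqxx.
Qed.

(* The head of a remote edge is at distance at least 3 from its tail. *)
Definition remote w v :=
  [&& e w v, ~~ e v w & [forall z, e v z ==> ~~ e z w]].

Lemma remoteP w v :
  reflect [/\ e w v, ~~ e v w & forall z, e v z -> ~~ e z w] (remote w v).
Proof.
apply: (iffP and3P) => -[wv vw far]; split=> //.
  by move=> z vz; apply: implyP (forallP far z) vz.
by apply/forallP => z; apply/implyP; apply: far.
Qed.

Section RemoteWalk.
Variable b : nat -> T.
Hypothesis b_remote : forall i, remote (b i) (b i.+1).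

Let bS i : e (b i) (b i.+1). Proof. by case/remoteP: (b_remote i). Qed.
Let bSN i : ~~ e (b i.+1) (b i). Proof. by case/remoteP: (b_remote i). Qed.
Let bSz i z : e (b i.+1) z -> ~~ e z (b i).
Proof. by case/remoteP: (b_remote i) => _ _; apply. Qed.

(** A backward edge contradicts remoteness; a forward edge closes a transitive triangle. *)
Lemma remote_walk2 i : ~~ adj (b i) (b i.+2).
Proof.
rewrite /adjacent (negPf (bSz (bS i.+1))) orbF; apply/negP => bi2.
have := e_ntt (bS i) (bS i.+1) bi2.
by rewrite (negPf (bSN i)) (negPf (bSN i.+1)) (negPf (bSz (bS i.+1))).
Qed.

Lemma remote_walk_out x i : e x (b i) -> ~~ e x (b i.+1).
Proof.
move=> xi; apply/negP => xi1; case: (e_alos xi1 xi (bS i.+1)).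
  by apply/negP/remote_walk2.
by move=> eqb; have := bSN i; rewrite [in e _ _]eqb bS.
Qed.

(** Arc-locality at [b i] gives the adjacency to [b i.+2]; an edge between [x] and [b i.+1] is then
    excluded by [remote_walk_out], remoteness or [e_ntt]. *)
Lemma remote_walk_succ i x : e (b i) x -> x != b i.+1 ->
  ~~ adj x (b i.+1) /\ adj x (b i.+2).
Proof.
move=> ix xi1.
have xi2 : adj x (b i.+2).
  apply: (alos_neq (bS i) ix (bS i.+1)); apply: contraTneq ix => ->.
  by have := remote_walk2 i; rewrite negb_or => /andP[].
split=> //; rewrite negb_or; have xNi1 : ~~ e x (b i.+1).
  apply/negP => x1; move: xi2; rewrite /adjacent (negPf (remote_walk_out x1)) /=.
  by move/bSz; rewrite x1.
rewrite xNi1 /=; apply/negP => i1x.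
have := e_ntt (bS i) i1x ix; rewrite (negPf (bSN i)) (negPf xNi1) /=.
by rewrite (negPf (bSz i1x)).
Qed.

(* A vertex at the end of a walk of length [k] from [b 1] behaves like [b k.+1];
   starting at [b 1] keeps the index [k] of the predecessor nonnegative. *)
Lemma remote_walk_adj k y : walk e k (b 1) y ->
  [/\ adj y (b k), ~~ adj y (b k.+1) & adj y (b k.+2)].
Proof.
elim: k y => [|k IH] y.
  by move/eqP=> <-; rewrite /adjacent e_irr bS (bS 1) orbT.
case/existsP => x /andP[/IH[adj0 nadj1 adj2] xy].
have ney2 : ~~ adj y (b k.+2).
  rewrite negb_or; have yN : ~~ e y (b k.+2).
    apply/negP => y2.
    have yk3 : y != b k.+3 by apply: contraTneq y2 => ->; apply: bSN.
    (* Whichever way the edge between [x] and [b k.+2] points, arc-locality on it joins [y] to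
       [b k.+3]. The same argument recurs below. *)
    have : adj y (b k.+3).
      case/orP: adj2 => [x2|x2]; first exact: (alos_neq x2 xy (bS _) yk3).
      by rewrite adjacent_sym; apply: (alos_neq x2 (bS _) xy); rewrite eq_sym.
    rewrite /adjacent (negPf (remote_walk_out y2)) /=.
    by move/bSz; rewrite y2.
  rewrite yN /=; apply/negP => y2.
  have [yk3|yk3] := eqVneq y (b k.+3).
    rewrite yk3 in xy; case/orP: adj2 => [/remote_walk_out|x2].
      by rewrite xy.
    have [|/norP[]] := remote_walk_succ x2; last by rewrite xy.
    by apply: contraTneq xy => ->; rewrite e_irr.
  have [] := remote_walk_succ y2 yk3; rewrite negb_or => /andP[/negPf y3 /negPf y3'].
  have : adj y (b k.+3).
    case/orP: adj2 => [x2|x2]; first exact: (alos_neq x2 xy (bS _) yk3).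
    by rewrite adjacent_sym; apply: (alos_neq x2 (bS _) xy); rewrite eq_sym.
  by rewrite /adjacent y3 y3'.
have yk3 : y != b k.+3 by apply: contraNneq ney2 => ->; rewrite /adjacent bS orbT.
have yk1 : y != b k.+1 by apply: contraNneq ney2 => ->; rewrite /adjacent bS.
split=> //.
  case/orP: adj0 => [x0|x0]; first exact: (alos_neq x0 xy (bS _) yk1).
  by rewrite adjacent_sym; apply: (alos_neq x0 (bS _) xy); rewrite eq_sym.
case/orP: adj2 => [x2|x2]; first exact: (alos_neq x2 xy (bS _) yk3).
by rewrite adjacent_sym; apply: (alos_neq x2 (bS _) xy); rewrite eq_sym.
Qed.

(* Otherwise the [b j] of the appropriate parity all dominate [y], which is
   then the end of walks of consecutive lengths. *)
Lemma remote_walk_back k l y : walk e k (b 1) y -> walk e l (b 1) y ->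
  odd (k + l) -> exists j, e y (b j).
Proof.
wlog ltkl : k l / k < l => [wlogH|] wk wl kl_odd.
  have [lt|lt|eqkl] := ltngtP k l; first exact: (wlogH k l lt).
    by apply: (wlogH l k lt wl wk); rewrite addnC.
  by rewrite eqkl addnn odd_double in kl_odd.
have [/existsP[j yj]|/existsPn noj] := boolP [exists j : 'I_l.+2, e y (b j)].
  by exists j.
have wkt t : k + t.*2 <= l -> walk e (k + t.*2) (b 1) y.
  elim: t => [|t IH]; first by rewrite addn0.
  rewrite doubleS !addnS => lel.
  have /remote_walk_adj[_ _] := IH (ltnW (ltnW lel)).
  have ltl : (k + t.*2).+2 < l.+2 by lia.
  rewrite /adjacent (negPf (noj (Ordinal ltl))) /= => by2.
  apply: walkS by2; have := @walk_seq _ e b 1 (k + t.*2).+1.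
  by rewrite add1n; apply=> j _; apply: bS.
(* The walk of length [l.-1] forbids adjacency of [y] to [b l]; the one of length [l] demands it. *)
have /remote_walk_adj[_ nadj _] := wkt (l - k)./2 ltac:(lia).
have /remote_walk_adj[+ _ _] := wl.
by rewrite (_ : l = (k + (l - k)./2.*2).+1) ?(negPf nadj) //; lia.
Qed.

End RemoteWalk.
End RemoteEdges.

(** * Closed walks as periodic sequences *)

Section ClosedWalks.
Variables (T : finType) (r : rel T).

Lemma walk_fun k x y : walk r k x y ->
  exists f : nat -> T, [/\ f 0 = x, f k = y & forall i, i < k -> r (f i) (f i.+1)].
Proof.
elim: k y => [|k IH] y; first by move/eqP=> <-; exists (fun=> x).
case/existsP => z /andP[/IH[f [f0 fk fS]] zy].
exists (fun i => if i <= k then f i else y); split=> //; first by rewrite ltnn.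
move=> i leik; have [ltik|] := ltnP i k; first by rewrite ltnW ?fS.
by rewrite -ltnS => leki; rewrite (_ : i = k) ?leqnn ?fk //; lia.
Qed.

Lemma closed_walk_fun n y : walk r n.+1 y y ->
  exists f : nat -> T, (forall i, r (f i) (f i.+1)) /\
                       (forall i, f (i + n.+1) = f i).
Proof.
case/walk_fun => f [f0 fn fS]; exists (fun i => f (i %% n.+1)); split=> i.
  have lti := ltn_pmod i (ltn0Sn n).
  rewrite (_ : i.+1 %% n.+1 = (i %% n.+1).+1 %% n.+1).
    have [eqi|neqi] := eqVneq (i %% n.+1) n; last first.
      by rewrite (@modn_small _.+1) ?fS //; lia.
    by rewrite eqi modnn f0 -fn fS.
  by rewrite -addn1 -modnDml addn1.
by rewrite modnDr.
Qed.

End ClosedWalks.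

(** * From odd closed walks to directed walks of both parities *)

Section OddWalks.
Variables (T : finType) (e : rel T).
Hypotheses (e_irr : irreflexive e) (e_alos : arc_locally_out_semicomplete e).
Local Notation adj := (adjacent e).

Definition parity_conflict u := exists y k l,
  [/\ walk e k u y, walk e l u y & odd (k + l)].

(* In a cyclic word of forward and backward steps, the pattern "backward,
   forward, forward" and its reversal contract to a single step; a word without
   such a pattern is constant or alternating. *)
Lemma odd_closed_walk n y : walk adj n y y -> odd n -> exists u, parity_conflict u.
Proof.
elim/ltn_ind: n y => -[|n] // IH y /closed_walk_fun[x [xS xn]] odd_n.
set goal := exists u, _.
pose F i := e (x i) (x i.+1).
have Fn i : F (i + n.+1) = F i by rewrite /F -addSn !xn.
have Fqn q i : F (i + q * n.+1) = F i.
  by elim: q => [|q IHq]; rewrite ?addn0 // mulSnr addnA Fn.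
have notF i : ~~ F i -> e (x i.+1) (x i).
  by rewrite /F; have := xS i; case/orP => ->.
(* One step replaces three, so the length drops from [n.+1] to [n.-1] and stays odd. *)
have contract i : adj (x i) (x i.+3) -> goal.
  have n2 : 1 < n.
    case: n odd_n xn {IH Fn Fqn} => [_ /(_ 0) x1|[//|//]].
    by have := xS 0; rewrite /adjacent -x1 e_irr.
  move=> xi3; apply: (IH (n.-1) _ (x i)); [by lia | | by lia].
  have := walk_trans (walk1 xi3) (walk_seq (i := i.+3) (k := n.-2) _).
  rewrite (_ : i.+3 + n.-2 = i + n.+1) ?xn; last by lia.
  by rewrite (_ : 1 + n.-2 = n.-1) //; [apply=> j _ | lia].
have BFF i : ~~ F i -> F i.+1 -> F i.+2 -> goal.
  move=> /notF Bi Fi1 Fi2; case: (e_alos Fi1 Bi Fi2) => [/contract//|eqx].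
  exists (x i.+1), (x i), 1, 2; split=> //; first exact: walk1.
  by rewrite eqx; apply: walkS Fi2; apply: walk1.
have BBF i : ~~ F i -> ~~ F i.+1 -> F i.+2 -> goal.
  move=> /notF Bi /notF Bi1 Fi2; case: (e_alos Bi1 Fi2 Bi) => [|eqx].
    by rewrite adjacent_sym => /contract.
  exists (x i.+2), (x i), 2, 1; split=> //; last by rewrite -eqx; apply: walk1.
  by apply: walkS Bi; apply: walk1.
have [allF|] := boolP [forall i : 'I_n.+1, F i].
  exists (x 0), (x 0), 0, n.+1; split=> //; first exact/eqP.
  rewrite -{2}(xn 0); apply: walk_seq => j ltj.
  by rewrite add0n; apply: forallP allF (Ordinal ltj).
case/forallPn => -[i /= lti] nFi.
have [noF|] := boolP [forall i : 'I_n.+1, ~~ F i].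
  have noFj j : ~~ F j.
    have ltj := ltn_pmod j (ltn0Sn n); rewrite (divn_eq j n.+1) addnC Fqn.
    by apply: forallP noF (Ordinal ltj).
  exists (x 0), (x 0), 0, n.+1; split=> //; first exact/eqP.
  rewrite -{1}(xn 0) add0n; elim: n.+1 => [|k IHk]; first exact/eqP.
  by rewrite -add1n; apply: walk_trans IHk; apply: walk1; apply: notF.
case/forallPn => -[j /= ltj]; rewrite negbK => Fj.
have ex_step i0 : exists t, F (i0 + t).
  exists (j + i0 * n.+1 - i0); rewrite subnKC ?Fqn //.
  by rewrite mulnS addnCA leq_addr.
have step i0 : ~~ F i0 -> F i0.+1 -> goal \/ (~~ F i0.+2 /\ F i0.+3).
  move=> nF0 F1; have [F2|nF2] := boolP (F i0.+2); first by left; apply: BFF F2.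
  have [F3|nF3] := boolP (F i0.+3); first by right.
  left; have [t Ft mint] := ex_minnP (ex_step i0.+3).
  case: t Ft mint => [|[|t]] Ft mint; first by rewrite addn0 (negPf nF3) in Ft.
    by apply: BBF nF2 nF3 _; rewrite addn1 in Ft.
  rewrite !addnS in Ft; apply: BBF Ft; rewrite -?addnS; apply/negP => /mint; lia.
have [t Ft mint] := ex_minnP (ex_step i).
case: t Ft mint => [|t] Ft mint; first by rewrite addn0 (negPf nFi) in Ft.
rewrite addnS in Ft; have nFt : ~~ F (i + t) by apply/negP => /mint; lia.
have alt k : goal \/ (~~ F (i + t + k.*2) /\ F (i + t + k.*2).+1).
  elim: k => [|k [|[nFk Fk]]]; [by right; rewrite addn0 | by left |].
  by rewrite doubleS !addnS; apply: step.
(* Alternation has period two but [F] has the odd period [n.+1]; they disagree at offset [n.+2]. *)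
have [//|[nFk _]] := alt n.+2./2.
have := Fn (i + t).+1; rewrite Ft (_ : _ + _ = i + t + n.+2./2.*2) ?(negPf nFk) //.
by have := odd_double_half n.+2; rewrite oddS odd_n; clear; lia.
Qed.

End OddWalks.

(** * Extended odd cycles *)

Section ExtendedCycles.
Variables (T : finType) (e : rel T).
Hypotheses (e_irr : irreflexive e) (e_alos : arc_locally_out_semicomplete e).
Hypothesis e_ntt : no_transitive_triangle e.
Local Notation adj := (adjacent e).

(** This is the condition under which [exists_remote_in_neighbour] applies. *)
Definition leaves u := [exists x, exists y, [&& e u x, e x y & y != u]].

Lemma leavesI u x y : e u x -> e x y -> y != u -> leaves u.
Proof.
by move=> ux xy yu; apply/existsP; exists x; apply/existsP; exists y; apply/and3P.
Qed.

(** Otherwise walks from [u] return to [u] at every even length and end at an out-neighbour at every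
    odd one. *)
Lemma parity_conflict_leaves u : parity_conflict e u -> leaves u.
Proof.
case=> y [k [l [wk wl odd_kl]]]; have [//|nleaves] := boolP (leaves u).
have parity j z : walk e j u z -> if odd j then e u z else z == u.
  elim: j z => [|j IH] z; first by rewrite eq_sym.
  case/existsP => t /andP[/IH]; rewrite oddS; case: (odd j) => /= [ut tz|/eqP->//].
  by apply: contraNT nleaves; exact: (leavesI ut tz).
move: odd_kl (parity _ _ wk) (parity _ _ wl); rewrite oddD.
by case: (odd k) (odd l) => [] [] //= _ => [uy /eqP eqy|/eqP eqy uy];
  rewrite eqy e_irr in uy.
Qed.

Definition remote_cycle m (b : nat -> T) :=
  [/\ 0 < m, forall i, remote e (b i) (b i.+1) & forall i, b (i + m) = b i].

(** A blow-up of a directed cycle of odd length at least 5. The edge clause ranges over all [y], so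
    no edge leaves the classes. *)
Definition extended_cycle h (C : nat -> {set T}) :=
  [/\ 1 < h, forall k, C (k + h.*2.+1) = C k, forall k, C k != set0,
      forall k x y, x \in C k -> e x y = (y \in C k.+1)
    & forall i j, i < j -> j < i + h.*2.+1 -> [disjoint C i & C j]].

Section RemoteCycle.
Variables (m : nat) (b : nat -> T).
Hypothesis b_cycle : remote_cycle m b.

Let b_remote : forall i, remote e (b i) (b i.+1). Proof. by case: b_cycle. Qed.
Let bS i : e (b i) (b i.+1). Proof. by case/remoteP: (b_remote i). Qed.
Let bm q i : b (i + q * m) = b i.
Proof.
case: b_cycle => _ _ bm; elim: q => [|q IHq]; first by rewrite addn0.
by rewrite mulSnr addnA bm.
Qed.

Lemma remote_cycle_walk i k : walk e k (b i) (b (i + k)).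
Proof. by apply: walk_seq => j _; apply: bS. Qed.

Lemma remote_cycle_return j : exists k, walk e k (b j) (b 1).
Proof.
case: b_cycle => m0 _ _; exists (j * m + 1 - j).
have := remote_cycle_walk j (j * m + 1 - j); rewrite subnKC; last by nia.
by rewrite addnC bm.
Qed.

Lemma remote_cycle_shift d : remote_cycle m (fun i => b (i + d)).
Proof.
case: b_cycle => m0 b_rem b_per; split=> // i.
by rewrite /= addnAC b_per.
Qed.

(* Take [h.*2] to be the smallest even index difference of two adjacent vertices
   of the remote cycle. *)
Lemma remote_cycle_odd_chord l : odd l -> walk e l (b 1) (b 1) ->
  exists i h, [/\ 1 < h, e (b (i + h.*2)) (b i)
    & forall i j, 0 < j -> j < h -> ~~ adj (b i) (b (i + j.*2))].
Proof.
move=> odd_l wl; case: b_cycle => m0 _ _.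
pose P j := (0 < j) && [exists i : 'I_m, adj (b i) (b (i + j.*2))].
have noP j i : 0 < j -> ~~ P j -> ~~ adj (b i) (b (i + j.*2)).
  move=> j0; rewrite /P j0 /= => /existsPn noj.
  have eqb d : b (i %% m + d) = b (i + d).
    by rewrite [in RHS](divn_eq i m) -addnA [in RHS]addnC bm.
  have := noj (Ordinal (ltn_pmod i m0)); rewrite /= eqb.
  by rewrite -[i %% m]addn0 eqb addn0.
have exP : exists j, P j.
  (* By [remote_walk_adj], the closed walk of length [l] makes [b 1] adjacent to [b l.+2]. *)
  exists l.+1./2.
  have [_ _ adj3] := remote_walk_adj e_irr e_alos e_ntt b_remote wl.
  have l_half : l.+1./2.*2 = l.+1.
    by have := odd_double_half l.+1; rewrite oddS odd_l.
  have [//|nP] := boolP (P l.+1./2).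
  by have := noP l.+1./2 1 ltac:(lia) nP; rewrite l_half add1n adj3.
have [h /andP[h0 /existsP[i hi]] minh] := ex_minnP exP.
have even_chord i' j : 0 < j -> j < h -> ~~ adj (b i') (b (i' + j.*2)).
  by move=> j0 ltjh; apply: noP => //; apply/negP => /minh; rewrite leqNgt ltjh.
have h1 : 1 < h.
  rewrite ltn_neqAle h0 andbT; apply: contraTneq hi => <-; rewrite addn2.
  exact: (remote_walk2 e_ntt b_remote).
(* A forward chord would, by arc-locality at [b i], give a shorter even chord between [b i.+2] and
   [b (i + h.*2)]. *)
exists i, h; split=> //; case/orP: hi => // hi.
have ih2 : b (i + h.*2) != b i.+2.
  apply: contraTneq hi => ->.
  by have := remote_walk2 e_ntt b_remote i; rewrite negb_or => /andP[].
have := alos_neq e_alos (bS i) hi (bS i.+1) ih2; rewrite adjacent_sym.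
rewrite (_ : i + h.*2 = i.+2 + h.-1.*2); last by lia.
by rewrite (negPf (even_chord _ _ _ _)) //; lia.
Qed.

Section Levels.
Variable h : nat.
Hypotheses (h1 : 1 < h) (b_close : e (b h.*2.+1) (b 1)).
Hypothesis even_chord : forall i j, 0 < j -> j < h -> ~~ adj (b i) (b (i + j.*2)).
Local Notation g := h.*2.+1.

(** From index 1 on, these become the classes of the blow-up; [level k] contains [b k.+1]. *)
Let level k := [set y | walk e k (b 1) y].

Let level_adj k y : y \in level k ->
  [/\ adj y (b k), ~~ adj y (b k.+1) & adj y (b k.+2)].
Proof. by rewrite inE; apply: (remote_walk_adj e_irr e_alos e_ntt b_remote). Qed.

Let levelS k x y : x \in level k -> e x y -> y \in level k.+1.
Proof. by rewrite !inE => wx; apply: walkS. Qed.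

Let b_level k : b k.+1 \in level k.
Proof. by rewrite inE; have := remote_cycle_walk 1 k. Qed.

Let b1_level : b 1 \in level g.
Proof. exact: levelS (b_level h.*2) b_close. Qed.

Let level_period k y : y \in level k -> y \in level (k + g).
Proof.
rewrite !inE addnC => wy; apply: walk_trans wy.
by have := b1_level; rewrite inE.
Qed.

(** For [j = h] this is [level_adj] one period later. For smaller [j], the head of a forward chord
    enters a level that forces a short even chord, while a backward chord persists as its tail
    advances by [g]. *)
Lemma remote_cycle_chord i j : 0 < j -> j <= h -> ~~ adj (b i) (b (i + j.*2.+1)).
Proof.
move=> j0 jh; case: b_cycle => m0 _ _.
suff {i}chord i : ~~ adj (b i.+1) (b (i.+1 + j.*2.+1)).
  have := chord (i + m.-1); rewrite (_ : (i + m.-1).+1 = i + 1 * m); last by lia.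
  by rewrite addnAC !bm.
move: jh.
rewrite leq_eqVlt => /predU1P[->|ltjh].
  have /level_adj[_ nadj _] := level_period (b_level i).
  by rewrite (_ : _ + _ = (i + g).+1) //; lia.
rewrite negb_or; apply/andP; split; apply/negP => eb.
  have /level_adj[+ _ _] := levelS (level_period (b_level i)) eb.
  rewrite (_ : (i + g).+1 = i.+1 + j.*2.+1 + (h - j).*2); last by lia.
  by apply/negP/even_chord; lia.
have shift s : e (b (i.+1 + j.*2.+1 + s * g)) (b i.+1).
  elim: s => [|s ev]; first by rewrite addn0.
  rewrite mulSnr addnA; set v := i + j.*2.+1 + s * g.
  rewrite -[_ + s * g]/v.+1 in ev *.
  have /level_adj[+ _ _] := levelS (level_period (b_level v)) ev.
  case/orP => // ev'; have /level_adj[_ _] := levelS (levelS (b_level v) ev) ev'.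
  rewrite adjacent_sym (_ : (v + g).+1 = v.+4 + h.-1.*2); last by lia.
  by apply: contraTT => _; apply: even_chord; lia.
(* After [m.-1] advances the tail lies [(h - j).*2] before a copy of [b i.+1], at even distance less
   than [h.*2]. *)
have := shift m.-1; apply/negP.
have : ~~ adj (b (i.+1 + j.*2.+1 + m.-1 * g)) (b (i.+1 + g * m)).
  rewrite (_ : i.+1 + g * m = i.+1 + j.*2.+1 + m.-1 * g + (h - j).*2).
    by apply: even_chord; lia.
  rewrite -{1}(prednK m0) mulnSr mulnC; lia.
by rewrite bm negb_or => /andP[].
Qed.

(** An edge from [b k.+2] to [y] would lift [y] two levels at a time up to [level (k + h.*2.+2)],
    contradicting its place in [level (k + g)]. *)
Let level_out k y : y \in level k -> e y (b k.+2) /\ ~~ e (b k.+2) y.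
Proof.
move=> yk; have /level_adj[_ _ adj2] := yk.
suff nby : ~~ e (b k.+2) y by move: adj2; rewrite /adjacent (negPf nby) orbF.
apply/negP => by2.
have climb t : t <= h -> y \in level (k + t.*2.+2).
  elim: t => [|t IH] leth; first by rewrite addn2; apply: levelS by2.
  have /level_adj[_ _ /orP[yb|yb]] := IH (ltnW leth); last first.
    by rewrite doubleS -addn2 addnA addn2; apply: levelS yb.
  have /level_adj[_ _ _] := levelS yk yb; have /level_adj[+ _ _] := levelS yk yb.
  rewrite adjacent_sym (_ : (k + _).+2 = k.+1 + t.+1.*2.+1); last by lia.
  by rewrite (negPf (remote_cycle_chord _ _ _)).
have /level_adj[+ _ _] := climb h (leqnn h).
have /level_adj[_ + _] := level_period yk.
by rewrite -addnS => /negPf->.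
Qed.

Let level_in k y : y \in level k -> e (b k) y.
Proof.
move=> yk; have /level_adj[/orP[//|]//] := yk => yb.
have /level_adj[_ _] := levelS yk yb.
by rewrite -[k.+3](addn3 k) (negPf (@remote_cycle_chord k 1 _ _)) //; lia.
Qed.

(** Arc-locality at [b k] joins consecutive levels; a backward edge would put [y] in [level k.+2],
    against [level_out]. *)
Let level_step k y z : y \in level k -> e y z = (z \in level k.+1).
Proof.
move=> yk; apply/idP/idP => [|zk]; first exact: levelS.
have [by2 nby2] := level_out yk.
have yz : y != z.
  apply: contraTneq by2 => eqyz; have /level_adj[_] := zk.
  by rewrite -eqyz negb_or => /andP[].
have := alos_neq e_alos (bS k) (level_in yk) (level_in zk) yz.
case/orP => // zy; have /level_in := levelS zk zy.
by rewrite (negPf nby2).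
Qed.

Let levelE k l y : y \in level k -> y \in level l -> level k.+1 = level l.+1.
Proof.
by move=> yk yl; apply/setP => z; rewrite -(level_step _ yk) (level_step _ yl).
Qed.

Let level_add k l y t : y \in level k -> y \in level l ->
  level (k + t).+1 = level (l + t).+1.
Proof.
move=> yk yl; elim: t => [|t IHt]; first by rewrite !addn0 (levelE yk yl).
by rewrite !addnS; apply: (@levelE _ _ (b (k + t).+2)); rewrite -?IHt b_level.
Qed.

(** The shift by [g] skips [level 0], which is only the singleton of [b 1]: periodicity starts at
    index 1. *)
Lemma levels_extended_cycle : extended_cycle h (fun k => level (k + g)).
Proof.
split=> // [k|k|k x y|i j ltij ltjg].
- rewrite (_ : k + g + g = (g + (k + h.*2)).+1); last by lia.
  rewrite (_ : k + g = (0 + (k + h.*2)).+1); last by lia.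
  exact: level_add b1_level (b_level 0).
- by apply/set0Pn; exists (b (k + g).+1).
- by rewrite addSn; apply: level_step.
rewrite -setI_eq0; apply: contraTT isT => /set0Pn[y /setIP[yi yj]].
have := b_level (i + g).+1; rewrite (levelE yi yj) => /level_adj[adj1 _ adj3].
have [v eqv] : exists v, v = (i + g).+2 by exists (i + g).+2.
rewrite -eqv in adj1 adj3.
have := odd_double_half (j - i); move: (_./2) => t; case: (odd _) => eqt.
  have [ltt|lett] := ltnP t.+1 h.
        move: adj3; rewrite (_ : (j + g).+3 = v + t.+1.*2); last by lia.
    by rewrite (negPf (even_chord _ _ _)).
  move: adj1; rewrite (_ : (j + g).+1 = v + t.*2); last by lia.
  by rewrite (negPf (even_chord _ _ _)) //; lia.
move: adj3; rewrite (_ : (j + g).+3 = v + t.*2.+1); last by lia.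
by rewrite (negPf (remote_cycle_chord _ _ _)) //; lia.
Qed.

End Levels.
End RemoteCycle.

Hypothesis leaves_remote : forall v, leaves v -> exists w, remote e w v.

(** A remote in-neighbour of a vertex that leaves also leaves, so one can step back forever and must
    loop. *)
Lemma remote_cycle_to u : leaves u ->
  exists m b k, remote_cycle m b /\ walk e k (b 1) u.
Proof.
move=> leaves_u; pose f v := odflt v [pick w | remote e w v].
have f_remote v : leaves v -> remote e (f v) v.
  move=> /leaves_remote[w wv]; rewrite /f; case: pickP => //= /(_ w).
  by rewrite wv.
have f_leaves v : leaves v -> leaves (f v).
  move=> lv; have /remoteP[fv vf _] := f_remote v lv.
  case/existsP: lv => x /existsP[y /and3P[vx _ _]].
  by apply: (leavesI fv vx); apply: contraNneq vf => <-.
have iter_leaves k : leaves (iter k f u) by elim: k => //= k; apply: f_leaves.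
have iter_walk i : walk e i (iter i f u) u.
  elim: i => [|i IHi]; first exact/eqP.
  rewrite -add1n; apply: walk_trans IHi; apply: walk1.
  by case/remoteP: (f_remote _ (iter_leaves i)).
have /trajectP[i lti eqi] := looping_order f u.
set n := order f u in lti eqi.
pose m := n - i; pose c := iter i f u.
have fm : iter m f c = c by rewrite -iterD subnK // ltnW.
(* Since [f] steps against the edges on a loop of length [m], one step forward is [m.-1]
   applications of [f]. *)
pose b t := iter (t * m.-1) f c.
have fb t : f (b t.+1) = b t.
  rewrite -[f _]/(iter 1 f (b t.+1)) -iterD /b.
  by rewrite (_ : 1 + _ = t * m.-1 + m) ?iterD ?fm // mulSn; lia.
have b_rem t : remote e (b t) (b t.+1).
  by rewrite -fb; apply: f_remote; rewrite /b -iterD.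
have bm t : b (t + m) = b t.
  by rewrite /b mulnDl iterD (_ : iter (m * _) f c = c) // mulnC iterM iter_fix.
have m0 : 0 < m by rewrite subn_gt0.
have b_cyc : remote_cycle m b by [].
exists m, b, (m.-1 + i); split=> //.
apply: walk_trans (iter_walk i); have := remote_cycle_walk b_cyc 1 m.-1.
by rewrite (_ : 1 + m.-1 = 0 + m) ?bm //; lia.
Qed.

Lemma extended_cycle_walk h C k l x y : extended_cycle h C ->
  x \in C k -> y \in C (k + l.+1) -> walk e l.+1 x y.
Proof.
case=> _ _ C0 CS _ xk; elim: l y => [|l IHl] y yl.
  by apply: walk1; rewrite (CS _ _ _ xk) -addn1.
have [z zl] := set0Pn _ (C0 (k + l.+1)).
by apply: (walkS (IHl z zl)); rewrite (CS _ _ _ zl) -addnS.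
Qed.

Lemma extended_cycle_out h C k l x y : extended_cycle h C ->
  x \in C k -> walk e l x y -> y \in C (k + l).
Proof.
case=> _ _ _ CS _ xk; elim: l y => [|l IHl] y.
  by move/eqP=> <-; rewrite addn0.
by case/existsP => z /andP[/IHl zl]; rewrite (CS _ _ _ zl) addnS.
Qed.

(** A remote cycle reaches [w], and then [y] in both parities by going once round the blow-up. Hence
    [y] has an edge back to the remote cycle, and the walk from [y] round to [w] cannot leave the
    classes. *)
Lemma extended_cycle_in h C k w y : extended_cycle h C ->
  e w y -> y \in C k -> exists k', w \in C k'.
Proof.
move=> cycC wy yk; have [_ Cg C0 CS _] := cycC.
have [z zk] := set0Pn _ (C0 k.+1).
have [eqzw|neqzw] := eqVneq z w; first by exists k.+1; rewrite -eqzw.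
have yz : e y z by rewrite (CS _ _ _ yk).
have [m [b [l [b_cyc wl]]]] := remote_cycle_to (leavesI wy yz neqzw).
have wy' : walk e h.*2.+1 y y by apply: (extended_cycle_walk cycC yk); rewrite Cg.
have [j yb] : exists j, e y (b j).
  have wly := walkS wl wy; case: (b_cyc) => _ b_rem _.
  apply: (remote_walk_back e_irr e_alos e_ntt b_rem wly (walk_trans wly wy')).
  by rewrite addnA addnn oddD odd_double /= odd_double.
have [l' wl'] := remote_cycle_return b_cyc j.
exists (k + (1 + (l' + l))); apply: (extended_cycle_out cycC yk).
exact: (walk_trans (walk1 yb) (walk_trans wl' wl)).
Qed.

Lemma exists_extended_cycle u : parity_conflict e u ->
  exists h C, extended_cycle h C.
Proof.
move=> conf_u.
have [m [b [n [b_cyc wn]]]] := remote_cycle_to (parity_conflict_leaves conf_u).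
case: (b_cyc) => m0 b_rem bm.
have [y [k [l [wk wl odd_kl]]]] := conf_u.
have wnk := walk_trans wn wk; have wnl := walk_trans wn wl.
have odd_nkl : odd (n + k + (n + l)) by rewrite addnACA oddD addnn odd_double.
have [j yb] := remote_walk_back e_irr e_alos e_ntt b_rem wnk wnl odd_nkl.
have [l' wl'] := remote_cycle_return b_cyc j.
(* Two closed walks through [y] differ in parity, so one is odd. *)
have [p [odd_p wp]] : exists p, odd p /\ walk e p (b 1) (b 1).
  have back q : walk e q (b 1) y -> walk e (q.+1 + l') (b 1) (b 1).
    by move=> wq; apply: walk_trans (walkS wq yb) wl'.
  have [odd1|even1] := boolP (odd ((n + k).+1 + l')).
    by exists ((n + k).+1 + l'); split=> //; apply: back.
  exists ((n + l).+1 + l'); split; last exact: back.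
  by move: odd_nkl even1; rewrite !oddD /= !oddD; do 4 case: (odd _).
have [i [h [h1 close even_chord]]] := remote_cycle_odd_chord b_cyc odd_p wp.
have b_cyc' := remote_cycle_shift b_cyc (i + m.-1).
exists h; eexists; apply: (levels_extended_cycle b_cyc' h1) => [|i' j' j0 ltj].
  rewrite (_ : h.*2.+1 + _ = i + h.*2 + m); last by lia.
  by rewrite (_ : 1 + _ = i + m) ?bm //; lia.
by rewrite addnAC; apply: even_chord.
Qed.

End ExtendedCycles.

(** * Counting stable sets in extended cycles *)

Section ExtendedCycleCount.
Variables (T : finType) (e : rel T) (V : {set T}) (h : nat) (C : nat -> {set T}).
Local Notation adj := (adjacent e).
Local Notation g := h.*2.+1.
Hypothesis e_irr : irreflexive e.
Hypotheses (indV : indecomposable adj V) (nclV : ~ clique adj V).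
Hypotheses (h1 : 1 < h) (Cg : forall k, C (k + g) = C k).
Hypothesis C0 : forall k, C k != set0.
Hypothesis CS : forall k x y, x \in C k -> y \in V -> e x y = (y \in C k.+1).
Hypothesis Cdis : forall i j, i < j -> j < i + g -> [disjoint C i & C j].
Hypothesis CV : forall k, C k \subset V.
Hypothesis VC : forall y, y \in V -> exists k, y \in C k.

Let inV k x : x \in C k -> x \in V. Proof. exact: subsetP (CV k) x. Qed.

Let C_mod i j : i = j %[mod g] -> C i = C j.
Proof.
have reduce k : C k = C (k %% g).
  rewrite {1}(divn_eq k g) addnC; elim: (k %/ g) => [|q IHq]; first by rewrite addn0.
  by rewrite mulSnr addnA Cg.
by rewrite (reduce i) (reduce j) => ->.
Qed.

Let C_near i j x : x \in C i -> x \in C j -> i < j + g -> j < i + g -> i = j.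
Proof.
wlog ltij : i j / i < j => [wlogH|] xi xj lti ltj.
  by have [lt|lt|//] := ltngtP i j; [apply: wlogH | apply/esym/wlogH].
by have /disjointFr/(_ xi) := Cdis ltij ltj; rewrite xj.
Qed.

Let C_idx i j x : x \in C i -> x \in C j -> i = j %[mod g].
Proof.
have mm k : C (k %% g) = C k by apply: C_mod; rewrite modn_mod.
rewrite -(mm i) -(mm j) => xi xj; have lt k : k %% g < g by rewrite ltn_pmod.
by apply: (C_near xi xj); rewrite ltn_addl.
Qed.

Let C_eq i j x : x \in C i -> x \in C j -> C i = C j.
Proof. by move=> xi xj; apply: C_mod; apply: C_idx xi xj. Qed.

Let C_pred i x y : x \in C i.+1 -> y \in V -> e y x -> y \in C i.
Proof.
move=> xi yV; have [j yj] := VC yV; rewrite (CS yj) ?(inV xi) // => xj.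
have /eqP := C_idx xi xj; rewrite -[i.+1]addn1 -[j.+1]addn1 eqn_modDr => /eqP/C_mod->.
exact: yj.
Qed.

Let V_from k y : y \in V -> exists2 t, t < g & y \in C (k + t).
Proof.
(* Modulo [g], adding [k * h.*2] subtracts [k]. *)
case/VC => j yj; exists ((j + k * h.*2) %% g); first by rewrite ltn_pmod.
rewrite (@C_mod _ j) // modnDmr addnCA -mulnS addnC.
by rewrite modnMDl.
Qed.

Let twins k x y z : x \in C k -> y \in C k -> z \in V -> adj x z = adj y z.
Proof.
move=> xk yk zV; rewrite /adjacent (CS xk zV) (CS yk zV); congr (_ || _).
have [j zj] := VC zV; rewrite (CS zj (inV xk)) (CS zj (inV yk)).
apply/idP/idP => wj; first by rewrite (C_eq wj xk).
by rewrite (C_eq wj yk).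
Qed.

(** Adding a twin of a member keeps [S] stable. *)
Let maximum_twins S k x : stableb adj S -> S \subset V -> alpha adj V <= #|S| ->
  x \in S -> x \in C k -> C k \subset S.
Proof.
move=> stS SV maxS xS xk; apply/subsetP => y yk; apply/negPn/negP => yNS.
have adj_sym := @adjacent_sym _ e.
have nadj z : z \in S -> ~~ adj y z.
  move=> zS; rewrite -(twins xk yk (subsetP SV z zS)).
  by move/stablebP: stS; apply.
suff : #|y |: S| <= alpha adj V by rewrite cardsU1 yNS ltnNge maxS.
apply: leq_alpha; last by rewrite subUset sub1set (inV yk).
apply/stablebP => u v /setU1P[->|uS] /setU1P[->|vS].
- by rewrite (adjacent_irr e_irr).
- exact: nadj.
- by rewrite adj_sym nadj.
- by move/stablebP: stS; apply.
Qed.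

(** Every second class from [k + 2] to [k + h.*2], thus avoiding classes [k] and [k.+1]. *)
Let E k := \bigcup_(r < h) C (k + r.*2.+2).

Let E_mem k r x : r < h -> x \in C (k + r.*2.+2) -> x \in E k.
Proof. by move=> ltr xr; apply/bigcupP; exists (Ordinal ltr). Qed.

Let E_V k : E k \subset V.
Proof. by apply/bigcupsP => r _; apply: CV. Qed.

Let E_stable k : stableb adj (E k).
Proof.
have nedge x y : x \in E k -> y \in E k -> ~~ e x y.
  move=> /bigcupP[[r /= ltr] _ xr] yE; rewrite (CS xr (subsetP (E_V k) y yE)).
  case/bigcupP: yE => -[s /= lts] _ ys; apply/negP => yr.
  by have := C_near yr ys ltac:(clear -ltr; lia) ltac:(clear -lts; lia); clear; lia.
by apply/stablebP => x y xE yE; rewrite negb_or !nedge.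
Qed.

(* A maximum stable set avoiding an edge from [C k] to [C k.+1] avoids both
   classes; by expansion it cannot leave [E k]. *)
Let card_E k : #|E k| = alpha adj V.
Proof.
have adj_sym := @adjacent_sym _ e; have adj_irr := adjacent_irr e_irr.
have [_ dec] := indV.
have [c ck] := set0Pn _ (C0 k); have [d dk] := set0Pn _ (C0 k.+1).
have cd : adj c d by rewrite /adjacent (CS ck) ?(inV dk) ?dk.
pose K := [set c; d].
have clK : clique adj K.
  move=> x y /set2P[]-> /set2P[]->; rewrite ?eqxx ?cd ?orbT //.
  by rewrite adj_sym cd orbT.
have KV : K \subset V by rewrite subUset !sub1set (inV ck) (inV dk).
have neqKV : K != V by apply/eqP => eqK; apply: nclV; rewrite -eqK.
have K0 : K != set0 by apply/set0Pn; exists c; rewrite !inE eqxx.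
have [S [stS SVK cardS]] := alpha_witness adj (V :\: K).
have maxS : alpha adj V <= #|S|.
  have := dec K KV K0 neqKV; have := alpha_clique clK.
  by rewrite -cardS; clear; lia.
have SV : S \subset V := subset_trans SVK (subsetDl _ _).
have avoid j y : y \in C j -> y \in K -> {in S, forall x, x \notin C j}.
  move=> yj yK x xS; apply/negP => xj.
  have := subsetP (maximum_twins stS SV maxS xS xj) y yj.
  by move/(subsetP SVK); rewrite inE yK.
have avoid0 := avoid _ _ ck (set21 c d); have avoid1 := avoid _ _ dk (set22 c d).
suff SE : S \subset E k.
  apply/eqP; rewrite eqn_leq leq_alpha //=; apply: leq_trans maxS _.
  exact: subset_leq_card.
rewrite -setD_eq0; apply/negPn/negP => Y0.
set Y := S :\: E k in Y0.
have YV : Y \subset V := subset_trans (subsetDl _ _) SV.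
have expY := indecomposable_expand adj_sym adj_irr indV nclV YV Y0
  (stableb_sub (subsetDl _ _) stS).
(* [Y] lies at odd offsets from 3 to [h.*2.-1], so its neighbours lie at even offsets; exchanging
   [Y] for them would enlarge [S]. *)
have NE : neighbours adj V Y \subset E k.
  apply/subsetP => z /neighboursP[zV [y /setDP[yS yE] yz]].
  have [t ltt yt] := V_from k (subsetP SV y yS).
  have t0 : t != 0 by apply: contraTneq yt => ->; rewrite addn0 avoid0.
  have t1 : t != 1 by apply: contraTneq yt => ->; rewrite addn1 avoid1.
  have [r [r0 ltr eqt]] : exists r, [/\ 0 < r, r < h & t = r.*2.+1].
    have := odd_double_half t; case: (odd t) => /= eqt.
      by exists t./2; move: t0 t1 ltt eqt; clear; move: t./2 => r; split; lia.
    case/negP: yE; apply: (@E_mem k t./2.-1); first by move: t0 ltt eqt; clear; lia.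
    by rewrite (_ : _.+2 = t) //; move: t0 eqt; clear; lia.
  case/orP: yz => [|zy].
    rewrite (CS yt zV) eqt => zr; apply: (@E_mem k r) => //.
    by rewrite !addnS in zr *.
  apply: (@E_mem k r.-1); first by move: ltr; clear; lia.
  apply: (@C_pred _ y) => //; rewrite (_ : _.+1 = k + t) //.
  by move: r0 eqt; clear; lia.
have dis : (S :&: E k) :&: neighbours adj V Y = set0.
  apply/setP => z; rewrite [RHS]in_set0; apply/negP.
  case/setIP => /setIP[zS _] /neighboursP[_ [y /setDP[yS _] yz]].
  by move/stablebP: stS => /(_ y z yS zS); rewrite yz.
have UE : (S :&: E k) :|: neighbours adj V Y \subset E k.
  by rewrite subUset subsetIr NE.
have := leq_alpha (stableb_sub UE (E_stable k)) (subset_trans UE (E_V k)).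
have := cardsUI (S :&: E k) (neighbours adj V Y).
by move: expY maxS; rewrite dis cards0 -(cardsID (E k) S) -/Y; clear; lia.
Qed.

(** [E i.+2] arises from [E i] by exchanging [C i.+2] for [C i.+1], and both have the same size. *)
Let card_C k : #|C k| = #|C 0|.
Proof.
have sumE i : #|E i| = \sum_(r < h) #|C (i + r.*2.+2)|.
  rewrite -sum1_card partition_disjoint_bigcup => [|r s neq_rs].
    by apply: eq_bigr => r _; rewrite sum1_card.
  rewrite -setI_eq0; apply: contraNT neq_rs => /set0Pn[x /setIP[xr xs]].
  have [ltr lts] := (ltn_ord r, ltn_ord s); apply/eqP/val_inj => /=.
  by have := C_near xr xs; move: ltr lts; clear; lia.
have step i : #|C i.+2| = #|C i.+1|.
  have := card_E i.+2; rewrite -(card_E i) !sumE.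
  have -> : h = h.-1.+1 by move: h1; clear; lia.
  rewrite big_ord_recr big_ord_recl /= addn2 addnC.
  have -> : i.+2 + h.-1.*2.+2 = i.+1 + g by move: h1; clear; lia.
  rewrite Cg; under [X in _ + X = _]eq_bigr => r _ do rewrite !addSnnS.
  by move/addIn.
have all1 i : #|C i.+1| = #|C 1| by elim: i => // i <-; apply: step.
by rewrite -(Cg k) -(Cg 0) !addnS !all1.
Qed.

(** Of two consecutive classes [S] misses one. Dropping a missed class leaves [h] consecutive pairs,
    each contributing at most [q]. *)
Let stable_bound S q : stableb adj S -> S \subset V ->
  (forall k, #|S :&: C k| <= q) -> #|S| <= h * q.
Proof.
move=> stS SV boundS; pose f k := #|S :&: C k|.
have alternate k : (f k == 0) || (f k.+1 == 0).
  rewrite !cards_eq0; apply/norP.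
  case=> /set0Pn[x /setIP[xS xk]] /set0Pn[y /setIP[yS yk]].
  move/stablebP: stS => /(_ x y xS yS); rewrite /adjacent.
  by rewrite (CS xk (inV yk)) yk.
have f2 k : f k + f k.+1 <= q.
  by case/orP: (alternate k) => /eqP->; rewrite ?addn0; apply: boundS.
have sum2 p F : (forall k, F k + F k.+1 <= q) -> \sum_(k < p.*2) F k <= p * q.
  move=> F2; elim: p => [|p IHp]; first by rewrite big_ord0.
  by rewrite doubleS !big_ord_recr /= -addnA mulSnr leq_add.
have : #|S| <= \sum_(k < g) f k.
  have -> : S = \bigcup_(k < g) (S :&: C k).
    apply/setP => x; apply/idP/bigcupP => [xS|[k _ /setIP[]//]].
    have [t ltt xt] := V_from 0 (subsetP SV x xS).
    by exists (Ordinal ltt); rewrite // inE xS.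
  apply: (big_ind2 (fun (A : {set T}) n => #|A| <= n)) => [|A m B n Am Bn|k _].
  - by rewrite cards0.
  - by apply: leq_trans (leq_add Am Bn); rewrite cardsU leq_subr.
  exact: leqnn.
move/leq_trans; apply; case/orP: (alternate h.*2) => /eqP fh.
  by rewrite big_ord_recr /= fh addn0 sum2.
rewrite -[_.+1]add0n /f Cg -/(f _) in fh.
by rewrite big_ord_recl /= fh; apply: (sum2 h (fun k => f k.+1)).
Qed.

(** A transversal [Z] of the classes and its complement have stability numbers at most [h] and
    [h * #|C 0|.-1], which add up to [alpha adj V]; so [Z] is all of [V]. *)
Lemma extended_cycle_hole : directed_hole e V.
Proof.
have [x0 _] := set0Pn _ (C0 0); pose c k := odflt x0 [pick x in C k].
have cC k : c k \in C k.
  rewrite /c; case: pickP => //= empty; have [x] := set0Pn _ (C0 k).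
  by rewrite empty.
have cE i k : c i \in C k -> c i = c k by move=> ik; rewrite /c (C_eq ik (cC i)).
have cg k : c (k + g) = c k by rewrite /c Cg.
pose Z := [set c i | i : 'I_g].
have cZ k : c k \in Z.
  have [t ltt kt] := V_from 0 (inV (cC k)).
  by rewrite (cE _ _ kt); apply/imsetP; exists (Ordinal ltt).
have ZP x : x \in Z -> exists i, x = c i by case/imsetP => i _ ->; exists i.
have ZV : Z \subset V by apply/subsetP => x /ZP[i ->]; apply: inV (cC i).
have cardC_pos : 0 < #|C 0| by rewrite card_gt0.
have alphaZ : alpha adj Z <= h * 1.
  apply/alpha_leP => S stS SZ; apply: stable_bound => //.
    exact: subset_trans SZ ZV.
  move=> k; rewrite -(cards1 (c k)); apply: subset_leq_card.
  apply/subsetP => x /setIP[/(subsetP SZ)/ZP[i ->] ik].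
  by rewrite inE (cE _ _ ik).
have alphaVZ : alpha adj (V :\: Z) <= h * #|C 0|.-1.
  apply/alpha_leP => S stS SVZ; apply: stable_bound => //.
    exact: subset_trans SVZ (subsetDl _ _).
  move=> k; rewrite -(card_C k) (cardsD1 (c k) (C k)) cC; apply: subset_leq_card.
  apply/subsetP => x /setIP[/(subsetP SVZ)/setDP[_ xZ] xk].
  by rewrite !inE xk andbT; apply: contraNneq xZ => ->.
have alphaV : alpha adj V = h * #|C 0|.
  rewrite -(card_E 0) -sum1_card partition_disjoint_bigcup => [|r s neq_rs].
    under eq_bigr => r _ do rewrite sum1_card card_C.
    by rewrite sum_nat_const card_ord.
  rewrite -setI_eq0; apply: contraNT neq_rs => /set0Pn[x /setIP[xr xs]].
  have [ltr lts] := (ltn_ord r, ltn_ord s); apply/eqP/val_inj => /=.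
  by have := C_near xr xs; move: ltr lts; clear; lia.
have eqZV : Z = V.
  have [_ dec] := indV; have Z0 : Z != set0 by apply/set0Pn; exists (c 0).
  apply/eqP/negPn/negP => neqZV; have := dec Z ZV Z0 neqZV.
  rewrite alphaV ltnNge => /negP[]; apply: leq_trans (leq_add alphaZ alphaVZ) _.
  by rewrite -mulnDr add1n prednK.
have VP x : x \in V -> exists i, x = c i by rewrite -eqZV; apply: ZP.
have edge i j : e (c i) (c j) = (c j == c i.+1).
  rewrite (CS (cC i) (inV (cC j))); apply/idP/eqP => [|->]; last exact: cC.
  exact: cE.
pose s x := odflt x [pick y in V | e x y].
have sc i : s (c i) = c i.+1.
  rewrite /s; case: pickP => /= [y /andP[/VP[j ->]]|/(_ (c i.+1))].
    by rewrite edge => /eqP.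
  by rewrite edge eqxx (inV (cC _)).
exists s; split.
- by move=> _ /VP[i ->]; rewrite sc -eqZV.
- by move=> _ _ /VP[i ->] /VP[j ->]; rewrite sc edge.
- move=> _ _ /VP[i ->] /VP[j ->]; rewrite !sc => eqc.
  have := cC i.+1; rewrite eqc => ci; have /eqP := C_idx ci (cC j.+1).
  rewrite -[i.+1]addn1 -[j.+1]addn1 eqn_modDr => /eqP/C_mod eqC.
  by rewrite /c eqC.
- move=> _ /VP[i ->]; exists (c (i + h.*2)); first by rewrite -eqZV.
  by rewrite sc -addnS cg.
move=> _ /VP[i ->]; rewrite !sc; apply/andP; split; apply/negP => /eqP eqc.
  by have := C_near (cC i.+2); rewrite eqc => /(_ _ (cC i)); move: h1; clear; lia.
by have := C_near (cC i.+3); rewrite eqc => /(_ _ (cC i)); move: h1; clear; lia.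
Qed.

End ExtendedCycleCount.

(** * Indecomposable sets are cliques or holes *)

Section Structure.
Variables (T : finType) (e : rel T).
Hypotheses (e_irr : irreflexive e) (e_alos : arc_locally_out_semicomplete e).
Hypothesis e_ntt : no_transitive_triangle e.
Implicit Types (V W : {set T}).
Local Notation adj := (adjacent e).

(** Keeping the type [T] lets the walk lemmas apply to a piece [V] without a subtype. *)
Definition restrict V : rel T := fun x y => [&& x \in V, y \in V & e x y].

Lemma restrictP V x y : reflect [/\ x \in V, y \in V & e x y] (restrict V x y).
Proof. exact: and3P. Qed.

Lemma restrict_adjacent V x y : x \in V -> y \in V ->
  adjacent (restrict V) x y = adj x y.
Proof. by move=> xV yV; rewrite /adjacent /restrict xV yV. Qed.

Lemma restrict_irr V : irreflexive (restrict V).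
Proof. by move=> x; rewrite /restrict e_irr !andbF. Qed.

Lemma restrict_alos V : arc_locally_out_semicomplete (restrict V).
Proof.
move=> u v x y /restrictP[uV vV uv] /restrictP[_ xV ux] /restrictP[_ yV vy].
by rewrite restrict_adjacent //; apply: e_alos uv ux vy.
Qed.

Lemma restrict_ntt V : no_transitive_triangle (restrict V).
Proof.
move=> x y z /restrictP[xV yV xy] /restrictP[_ zV yz] /restrictP[_ _ xz].
by rewrite /restrict xV yV zV; apply: e_ntt.
Qed.

(** Connectivity in the bipartite double cover: if no vertex is reached in both parities, the
    parities bipartition [V]. *)
Lemma exists_odd_closed_walk V : indecomposable adj V -> ~ clique adj V ->
  exists n y, walk (adjacent (restrict V)) n y y /\ odd n.
Proof.
move=> indV nclV; have [/set0Pn[r rV] _] := indV.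
pose r_adj := adjacent (restrict V).
have r_sym : symmetric r_adj := @adjacent_sym _ _.
pose d (p q : T * bool) := r_adj p.1 q.1 && (q.2 == ~~ p.2).
have connect_walk i y : connect d (r, false) (y, i) ->
    exists2 k, walk r_adj k r y & odd k = i.
  case/connectP => p; elim/last_ind: p y i => [|p [z j] IHp] y i.
    by move=> _ [-> ->]; exists 0 => //; apply/eqP.
  rewrite rcons_path last_rcons => /andP[dp]; case: (last _ _) (IHp) => t l IHt.
  have [k wk odd_k] := IHt t l dp erefl.
  rewrite /d /= => /andP[tz /eqP eqj] [-> ->].
  by exists k.+1; [apply: walkS tz | rewrite /= odd_k eqj].
pose P i := [set y in V | connect d (r, false) (y, i)].
have stepP i y z : y \in P i -> z \in V -> adj y z -> z \in P (~~ i).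
  rewrite [y \in _]inE => /andP[yV ry] zV yz; rewrite inE zV.
  apply: connect_trans ry (connect1 _).
  by rewrite -[d _ _]/(r_adj y z && _) /r_adj restrict_adjacent // yz eqxx.
have PV : P false :|: P true = V.
  apply: (indecomposable_connected (@adjacent_sym _ e) indV).
  - by apply/subsetP => y; rewrite !inE => /orP[] /andP[].
  - by apply/set0Pn; exists r; rewrite !inE rV connect0.
  move=> x y; rewrite in_setU => xP /setDP[yV yP]; apply: contra yP => xy.
  by rewrite in_setU orbC; case/orP: xP => /stepP/(_ yV xy)->; rewrite ?orbT.
have [P0|/set0Pn[y /setIP[]]] := eqVneq (P false :&: P true) set0; last first.
  rewrite !inE => /andP[_ /connect_walk[k wk even_k]].
  case/andP=> _ /connect_walk[l wl odd_l].
  exists (k + l), r; rewrite oddD even_k odd_l; split=> //; apply: walk_trans wk _.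
  by rewrite walk_sym.
have stP i : stableb adj (P i).
  apply/stablebP => x y xP yP; apply/negP => xy.
  have yV : y \in V by move: yP; rewrite inE => /andP[].
  have yP' := stepP _ _ _ xP yV xy; have := in_set0 y; rewrite -P0 in_setI.
  by case: i xP yP yP' => _ -> ->.
by case: (indecomposable_not_bipartite (@adjacent_sym _ e) (adjacent_irr e_irr)
  indV nclV PV).
Qed.

Theorem indecomposable_clique_or_hole V : indecomposable adj V ->
  clique adj V \/ directed_hole e V.
Proof.
have [n] := ubnP #|V|; elim: n V => // n IHn V ltVn indV.
have [/forall_inP clV|nclV] := boolP
    [forall x in V, [forall y in V, (x == y) || adj x y]].
  by left=> x y xV yV; have /forall_inP := clV x xV; apply.
have {}nclV : ~ clique adj V.
  move=> clV; case/negP: nclV.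
  by apply/forall_inP => x xV; apply/forall_inP => y yV; apply: clV.
right; pose r := restrict V.
have IH (B : {set T}) : B \subset V -> B != V -> indecomposable adj B ->
    clique adj B \/ directed_hole e B.
  move=> BV neqBV; apply: IHn; rewrite -ltnS; apply: leq_trans ltVn.
  by rewrite ltnS; apply: proper_card; rewrite properEneq neqBV.
have leaves_remote v : leaves r v -> exists w, remote r w v.
  case/existsP => x /existsP[y /and3P[/restrictP[vV xV vx] /restrictP[_ yV xy] yv]].
  have [w [wV wv vw far]] := exists_remote_in_neighbour e_irr e_alos indV nclV IH
    vV xV yV vx xy yv.
  exists w; apply/remoteP; split.
  - exact/restrictP.
  - by rewrite /r /restrict vV wV.
  by move=> z /restrictP[_ zV vz]; rewrite /r /restrict zV wV far.
have irr_r : irreflexive r by apply: restrict_irr.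
have alos_r : arc_locally_out_semicomplete r by apply: restrict_alos.
have ntt_r : no_transitive_triangle r by apply: restrict_ntt.
have [k [y [wk odd_k]]] := exists_odd_closed_walk indV nclV.
have [u conf_u] := odd_closed_walk irr_r alos_r wk odd_k.
have [h [C cycC]] := exists_extended_cycle irr_r alos_r ntt_r leaves_remote conf_u.
have [h1 Cg C0 CS Cdis] := cycC.
have CV j : C j \subset V.
  apply/subsetP => x xj; have [z zj] := set0Pn _ (C0 j.+1).
  by have := CS _ _ z xj; rewrite zj => /restrictP[].
have CSV j x z : x \in C j -> z \in V -> e x z = (z \in C j.+1).
  by move=> xj zV; rewrite -(CS _ _ _ xj) /r /restrict zV (subsetP (CV j) _ xj).
pose W := \bigcup_(j < h.*2.+1) C j.
have WP x : reflect (exists j, x \in C j) (x \in W).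
  apply: (iffP bigcupP) => [[j _ xj]|[j xj]]; first by exists j.
  exists (Ordinal (ltn_pmod j (ltn0Sn h.*2))) => //=.
  suff Cq q i : C (i + q * h.*2.+1) = C i.
    by rewrite -(Cq (j %/ h.*2.+1)) addnC -divn_eq.
  by elim: q => [|q IHq]; rewrite ?addn0 // mulSnr addnA Cg.
(* No edge of [V] leaves the classes by [CSV], and none enters by [extended_cycle_in]. *)
have eqWV : W = V.
  apply: (indecomposable_connected (@adjacent_sym _ e) indV).
  - by apply/bigcupsP.
  - by have [x xC] := set0Pn _ (C0 0); apply/set0Pn; exists x; apply/WP; exists 0.
  move=> x z /WP[j xj] /setDP[zV zW]; apply: contra zW.
  have xV := subsetP (CV j) x xj.
  case/orP => [xz|zx]; apply/WP; first by exists j.+1; rewrite -(CSV _ _ _ xj zV).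
  apply: (extended_cycle_in irr_r alos_r ntt_r leaves_remote cycC _ xj).
  exact/restrictP.
apply: (extended_cycle_hole e_irr indV nclV h1 Cg C0 CSV Cdis CV) => x.
by rewrite -eqWV => /WP.
Qed.

End Structure.

(** * Paths in semicomplete digraphs *)

Section SemicompletePaths.
Variables (T : finType) (r : rel T) (K : {set T}).
Hypothesis r_total : {in K &, forall x y, x != y -> r x y || r y x}.

(** Insert [v] right after the last vertex dominating it; the next vertex, if any, is then dominated
    by [v]. *)
Lemma path_insert s p v : v \in K -> {subset s :: p <= K} -> v \notin s :: p ->
  path r s p -> has (r^~ v) (s :: p) ->
  exists p1 p2, p = p1 ++ p2 /\ path r s (p1 ++ v :: p2).
Proof.
move=> vK; elim: p s => [|w p IH] s sub vN /=.
  by rewrite orbF => _ sv; exists [::], [::]; rewrite /= sv.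
case/andP=> sw pw; have wK : w \in K by apply: sub; rewrite !inE eqxx orbT.
have [hasw _|noh] := boolP (has (r^~ v) (w :: p)).
  have [||p1 [p2 [-> pth]]] := IH w _ _ pw hasw.
  - by move=> x xp; apply: sub; rewrite inE xp orbT.
  - by apply: contra vN => vp; rewrite inE vp orbT.
  by exists (w :: p1), p2; rewrite /= sw.
rewrite -/(has (r^~ v) (w :: p)) (negPf noh) orbF => sv; exists [::], (w :: p).
have vw : v != w by apply: contraNneq vN => ->; rewrite !inE eqxx orbT.
have := r_total vK wK vw; case/norP: noh => /negPf-> _; rewrite orbF => rvw.
by rewrite /= sv rvw pw.
Qed.

Lemma exists_dominated_path s : s \in K -> exists p,
  [/\ path r s p, uniq (s :: p), {subset s :: p <= K}
    & forall v, v \in K -> v \notin s :: p ->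
        {in s :: p, forall u, r v u && ~~ r u v}].
Proof.
move=> sK; set goal := exists p, _.
suff grow n p : #|K| - size p <= n -> path r s p -> uniq (s :: p) ->
    {subset s :: p <= K} -> goal.
  by apply: (grow #|K| [::]); rewrite ?leq_subr // => x; rewrite inE => /eqP->.
elim: n p => [|n IHn] p len pth unq sub.
  have : size (s :: p) <= #|K|.
    by rewrite -(card_uniqP unq); apply: subset_leq_card; apply/subsetP.
  by move: len => /=; clear; lia.
have [/exists_inP[v vK /andP[vN hasv]]|none] :=
  boolP [exists v in K, (v \notin s :: p) && has (r^~ v) (s :: p)].
  have [p1 [p2 [eqp pth']]] := path_insert vK sub vN pth hasv.
  have perm_vp : perm_eq (s :: p1 ++ v :: p2) (v :: s :: p).
    by rewrite eqp -!cat_cons perm_catC /= perm_cons perm_catC.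
  apply: (IHn (p1 ++ v :: p2)) => //.
  - by move: len; rewrite eqp !size_cat /=; clear; lia.
  - by rewrite (perm_uniq perm_vp) cons_uniq vN.
  by move=> x; rewrite (perm_mem perm_vp) inE => /predU1P[->|/sub].
exists p; split=> // v vK vN u up.
have nuv : ~~ r u v.
  apply: contra none => uv; apply/exists_inP; exists v; rewrite // vN.
  by apply/hasP; exists u.
have vu : v != u by apply: contraNneq vN => ->.
by have := r_total vK (sub u up) vu; rewrite (negPf nuv) orbF => ->.
Qed.

End SemicompletePaths.

(** * Path partitions *)

Section Partitions.
Variables (T : finType) (e : rel T).
Hypotheses (e_irr : irreflexive e) (e_alos : arc_locally_out_semicomplete e).
Hypothesis e_ntt : no_transitive_triangle e.
Implicit Types (B S V W : {set T}) (P : seq (seq T)).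
Local Notation adj := (adjacent e).

Definition BE_partition_on V S P :=
  [/\ {in P, forall p, dipath e p /\ {subset p <= V}},
      {in V, forall v, count (fun p : seq T => v \in p) P = 1},
      {in P, forall p : seq T, #|[set v in p] :&: S| = 1}
    & {in S, forall v, exists2 p, p \in P & starts_or_ends v p}].

(** Grow paths from [s] along the edges and against them. If they miss [a] and [b] respectively,
    then [a], [s], [b] form a transitive triangle without opposite edges. *)
Lemma clique_hamiltonian_path K s : clique adj K -> s \in K ->
  exists p, [/\ dipath e p, p =i K & starts_or_ends s p].
Proof.
move=> clK sK.
have total_e : {in K &, forall x y, x != y -> e x y || e y x}.
  by move=> x y xK yK /negPf xy; have := clK x y xK yK; rewrite xy.
have total_e' : {in K &, forall x y, x != y ->
    (fun z => e^~ z) x y || (fun z => e^~ z) y x}.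
  by move=> x y xK yK xy /=; rewrite orbC total_e.
have [p [pth unq sub dom]] := exists_dominated_path total_e sK.
have [Kp|] := boolP [forall x in K, x \in s :: p].
  exists (s :: p); split; [by rewrite /= pth | | by rewrite /= eqxx].
  by move=> x; apply/idP/idP => [/sub//|xK]; apply: (forall_inP Kp).
case/forall_inPn => a aK aNp; have /andP[as_ nsa] := dom a aK aNp s (mem_head s p).
have [q [pthq unqq subq domq]] := exists_dominated_path total_e' sK.
have [Kq|] := boolP [forall x in K, x \in s :: q].
  exists (rev (s :: q)).
  have revE : rev (s :: q) = last s q :: rev (belast s q).
    by rewrite lastI rev_rcons.
  split.
  - rewrite -[dipath _ _]/(dipath e (rev (s :: q))) revE /= rev_path pthq.
    by rewrite -cons_uniq -revE rev_uniq.
  - move=> x; rewrite mem_rev; apply/idP/idP => [/subq//|xK].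
    exact: (forall_inP Kq).
  have := last_rcons s (rev q) s; rewrite -rev_cons revE /= => ->.
  by rewrite eqxx orbT.
case/forall_inPn => b bK bNq; have /andP[sb nbs] := domq b bK bNq s (mem_head s q).
have bp : b \in s :: p.
  apply/negPn/negP => bNp; have /andP[] := dom b bK bNp s (mem_head s p).
  by rewrite (negPf nbs).
have /andP[ab nba] := dom a aK aNp b bp.
by have := e_ntt as_ sb ab; rewrite (negPf nsa) (negPf nbs) (negPf nba).
Qed.

Lemma clique_partition K S : clique adj K -> S \subset K -> #|S| = 1 ->
  exists P, BE_partition_on K S P.
Proof.
move=> clK SK /eqP/cards1P[s defS]; rewrite defS sub1set in SK *.
have [p [dip pK sp]] := clique_hamiltonian_path clK SK.
exists [:: p]; split.
- by move=> _ /predU1P[->|//]; split=> // x; rewrite pK.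
- by move=> v vK; rewrite /= pK vK.
- move=> _ /predU1P[->|//]; apply/eqP/cards1P; exists s.
  by apply/setIidPr; rewrite sub1set inE pK.
by move=> _ /set1P->; exists p; rewrite ?mem_head.
Qed.

(* Each path of the partition is [s] followed by one or two non-members of [S];
   maximality of [S] rules out three consecutive non-members. *)
Lemma hole_partition B S : directed_hole e B -> S \subset B -> stableb adj S ->
  alpha adj B <= #|S| -> exists P, BE_partition_on B S P.
Proof.
move=> [f [fB ef f_inj f_surj far]] /subsetP SB /stablebP stS maxS.
pose pth s := [:: s; f s] ++ (if f (f s) \in S then [::] else [:: f (f s)]).
have f_neq x : x \in B -> f x != x.
  by move=> xB; apply/eqP => fx; have := ef x x xB xB; rewrite e_irr fx eqxx.
have fS s : s \in S -> f s \notin S.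
  move=> sS; apply/negP => fsS; have := stS s (f s) sS fsS.
  by rewrite /adjacent ef ?eqxx // SB.
have gap x : x \in B -> x \notin S -> f x \notin S -> f (f x) \in S.
  move=> xB xNS fxNS; apply/negPn/negP => ffxNS.
  suff : #|f x |: S| <= alpha adj B by rewrite cardsU1 fxNS ltnNge maxS.
  apply: leq_alpha; last by rewrite subUset sub1set fB //=; apply/subsetP.
  have nadj z : z \in S -> ~~ adj (f x) z.
    move=> zS; have [zB fxB] := (SB z zS, fB x xB).
    rewrite negb_or (ef _ _ fxB zB) (ef _ _ zB fxB); apply/andP; split; apply/eqP.
      by move=> eqz; rewrite -eqz zS in ffxNS.
    by move/(f_inj _ _ xB zB) => eqz; rewrite eqz zS in xNS.
  apply/stablebP => u v /setU1P[->|uS] /setU1P[->|vS].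
  - by rewrite (adjacent_irr e_irr).
  - exact: nadj.
  - by rewrite adjacent_sym nadj.
  - exact: stS.
have pthB s : s \in S -> {subset pth s <= B}.
  move=> sS x; have sB := SB s sS; have fsB := fB s sB; have ffsB := fB _ fsB.
  rewrite /pth; case: ifP => _; rewrite !inE; last by case/or3P => /eqP->.
  by case/orP => /eqP->.
exists [seq pth s | s <- enum S]; split.
- move=> p /mapP[s]; rewrite mem_enum => sS ->; split; last exact: pthB.
  have sB := SB s sS; have fsB := fB s sB; have ffsB := fB _ fsB.
  have /andP[ffs _] := far s sB; have ffsfs := f_neq _ fsB; have fss := f_neq _ sB.
  rewrite /pth; case: ifP => _; rewrite /= !ef // !eqxx /= !inE.
    by rewrite eq_sym fss.
  by rewrite negb_or eq_sym fss eq_sym ffs eq_sym ffsfs.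
- move=> v vB.
  have [s [sS sv s_uniq]] : exists s, [/\ s \in S, v \in pth s
      & forall t, t \in S -> v \in pth t -> t = s].
    have pthP t : v \in pth t -> [\/ v = t, v = f t | v = f (f t) /\ v \notin S].
      rewrite /pth; case: ifP => ffS; rewrite !inE.
        by case/orP => /eqP; [constructor 1 | constructor 2].
      case/or3P => /eqP; [by constructor 1 | by constructor 2 | move=> ->].
      by rewrite ffS; constructor 3.
    have inj t x : t \in S -> x \in B -> f t = f x -> t = x.
      by move=> tS xB; apply: f_inj => //; apply: SB.
    have [vS|vNS] := boolP (v \in S).
      exists v; split=> //; first exact: mem_head.
      move=> t tS /pthP[->//|eqv|[_]]; last by rewrite vS.
      by move: (fS t tS); rewrite -eqv vS.
    have [u uB eqv] := f_surj v vB; have [uS|uNS] := boolP (u \in S).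
      exists u; split=> //; first by rewrite eqv !inE eqxx orbT.
      move=> t tS /pthP[eqt|eqt|[eqt _]].
      - by rewrite eqt tS in vNS.
      - by apply: inj => //; rewrite -eqt.
      have eqtu : f t = u by apply: f_inj; rewrite ?fB ?SB // -eqt.
      by move: (fS t tS); rewrite eqtu uS.
    have [w wB equ] := f_surj u uB.
    have wS : w \in S.
      apply/negPn/negP => wNS; move: (gap w wB wNS).
      by rewrite -equ -eqv (negPf vNS) => /(_ uNS).
    exists w; split=> //.
      by rewrite /pth -equ -eqv (negPf vNS) !inE eqxx !orbT.
    move=> t tS /pthP[eqt|eqt|[eqt _]].
    - by rewrite eqt tS in vNS.
    - have eqtu : t = u by apply: inj; rewrite // -eqt.
      by rewrite -eqtu tS in uNS.
    apply: inj => //; rewrite -equ; apply: (f_inj _ _ (fB _ (SB t tS)) uB).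
    by rewrite -eqt -eqv.
  rewrite count_map (@eq_in_count _ _ (pred1 s)) => [|t].
    by rewrite count_uniq_mem ?enum_uniq // mem_enum sS.
  by rewrite mem_enum /= => tS; apply/idP/eqP => [/s_uniq->|->].
- move=> p /mapP[s]; rewrite mem_enum => sS ->; apply/eqP/cards1P; exists s.
  apply/setP => x; rewrite in_setI in_set1 [x \in _]inE.
  apply/andP/eqP => [[xp xS]|->]; last by rewrite mem_head.
  move: xp xS; rewrite /pth; case: ifP => ffs; rewrite !inE.
    by case/orP => /eqP-> //; rewrite (negPf (fS s sS)).
  by case/or3P => /eqP-> //; rewrite ?(negPf (fS s sS)) ?ffs.
move=> s sS; exists (pth s); last by rewrite /= eqxx.
by apply: map_f; rewrite mem_enum.
Qed.

(** Additivity of [alpha] makes [S] maximum in the piece [B] and in [V :\: B]; the latter is handled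
    by induction. *)
Lemma exists_BE_partition V S : S \subset V -> stableb adj S ->
  alpha adj V <= #|S| -> exists P, BE_partition_on V S P.
Proof.
have [n] := ubnP #|V|; elim: n V S => // n IHn V S ltVn SV stS maxS.
have [V0|/set0Pn[v vV]] := eqVneq V set0.
  exists [::]; split=> // x; rewrite ?V0 ?inE // => xS.
  by have := subsetP SV x xS; rewrite V0 inE.
have [B [vB BV indB leB]] := exists_indecomposable adj vV.
have stB := stableb_sub (subsetIl S B) stS.
have stD := stableb_sub (subsetDl S B) stS.
have DV : S :\: B \subset V :\: B by apply: setSD.
have le1 := leq_alpha stB (subsetIr S B); have le2 := leq_alpha stD DV.
have cardS := cardsID B S.
have [P1 [dip1 cov1 one1 end1]] : exists P, BE_partition_on B (S :&: B) P.
  have maxB : alpha adj B <= #|S :&: B| by move: le2 cardS leB maxS; clear; lia.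
  case: (indecomposable_clique_or_hole e_irr e_alos e_ntt indB) => [clB|holeB].
    apply: clique_partition => //; first exact: subsetIr.
    apply/eqP; rewrite eqn_leq (leq_trans le1 (alpha_clique clB)) /=.
    apply: leq_trans maxB; rewrite -(cards1 v).
    apply: leq_alpha; last by rewrite sub1set.
    by apply/stablebP => x y /set1P-> /set1P->; rewrite (adjacent_irr e_irr).
  by apply: hole_partition => //; apply: subsetIr.
have [P2 [dip2 cov2 one2 end2]] : exists P, BE_partition_on (V :\: B) (S :\: B) P.
  apply: IHn => //; last by move: le1 cardS leB maxS; clear; lia.
  rewrite -ltnS; apply: leq_trans ltVn; rewrite ltnS; apply: proper_card.
  by apply/properP; split; [apply: subsetDl | exists v; rewrite // inE vB].
have count0 P W x : {in P, forall p, dipath e p /\ {subset p <= W}} -> x \notin W ->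
    count (fun p : seq T => x \in p) P = 0.
  move=> dip xW; apply/eqP; rewrite -leqn0 leqNgt -has_count; apply/hasPn => p pP.
  by apply: contra xW; case: (dip p pP) => _; apply.
exists (P1 ++ P2); split.
- move=> p; rewrite mem_cat => /orP[/dip1|/dip2] [dip sub]; split=> // x /sub.
    exact: subsetP.
  by case/setDP.
- move=> x xV; rewrite count_cat; have [xB|xB] := boolP (x \in B).
    by rewrite cov1 // (count0 _ _ _ dip2) // inE xB.
  by rewrite (count0 _ _ _ dip1) // cov2 // inE xB.
- move=> p; rewrite mem_cat => /orP[pP|pP].
    rewrite -(one1 p pP); congr #|pred_of_set _|; apply/setP => x; rewrite !inE.
    by case: (boolP (x \in p)) => //= /(proj2 (dip1 p pP))->; rewrite andbT.
  rewrite -(one2 p pP); congr #|pred_of_set _|; apply/setP => x; rewrite !inE.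
  by case: (boolP (x \in p)) => //= /(proj2 (dip2 p pP))/setDP[_ ->].
move=> x xS; have [xB|xB] := boolP (x \in B).
  have [|p pP xp] := end1 x; first by rewrite inE xS.
  by exists p; rewrite // mem_cat pP.
have [|p pP xp] := end2 x; first by rewrite inE xS xB.
by exists p; rewrite // mem_cat pP orbT.
Qed.

End Partitions.

(** * Blocking triangles and BE-diperfectness *)

Lemma no_blocking_transitive_triangle (T : finType) (e : rel T) :
  irreflexive e -> ~ contains_induced_blocking_odd_cycle e ->
  no_transitive_triangle e.
Proof.
move=> e_irr e_nboc x y z xy yz xz; apply: contra_notT e_nboc.
case/norP => nyx /norP[nzy nzx].
have neq u v : e u v -> u != v by apply: contraTneq => ->; rewrite e_irr.
have neq_xy := neq _ _ xy; have neq_yz := neq _ _ yz; have neq_xz := neq _ _ xz.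
pose A := [set x; y; z].
have xA : x \in A by rewrite !inE eqxx.
have yA : y \in A by rewrite !inE eqxx orbT.
have zA : z \in A by rewrite !inE eqxx orbT.
(* The order is [x], [z], [y]: the source comes first and the sink second. *)
pose f (i : 'I_3) : {v | v \in A} :=
  match nat_of_ord i with 0 => Sub x xA | 1 => Sub z zA | _ => Sub y yA end.
pose f' (v : {v | v \in A}) : 'I_3 :=
  if val v == x then inord 0 else if val v == z then inord 1 else inord 2.
have AP (v : {v | v \in A}) : [\/ v = Sub x xA, v = Sub y yA | v = Sub z zA].
  case: v => v vA; have := vA; rewrite !inE -orbA => /or3P[] /eqP eqv.
  - by constructor 1; apply: val_inj.
  - by constructor 2; apply: val_inj.
  - by constructor 3; apply: val_inj.
exists A, 1, f; split=> //.
- exists f' => [[[|[|[|//]]] lti]|v].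
  + by apply: val_inj; rewrite /f' /= eqxx inordK.
  + by apply: val_inj; rewrite /f' /= eq_sym (negPf neq_xz) eqxx inordK.
  + apply: val_inj; rewrite /f' /= eq_sym (negPf neq_xy) (negPf neq_yz) inordK //.
  case: (AP v) => ->; rewrite /f' /= ?eqxx.
  + by rewrite /f inordK.
  + by rewrite eq_sym (negPf neq_xy) (negPf neq_yz) /f inordK.
  + by rewrite eq_sym (negPf neq_xz) /f inordK.
- case=> [[|[|[|//]]] lti] [[|[|[|//]]] ltj];
    rewrite /adjacent /induced /f /= ?e_irr ?xy ?yz ?xz ?orbT //.
- by move=> v; case: (AP v) => ->; rewrite /induced /= ?e_irr.
by move=> v; case: (AP v) => ->; rewrite /induced /= ?e_irr.
Qed.

Theorem theorem30 (T : finType) (e : rel T) (e_irr : irreflexive e)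
    (e_alos : arc_locally_out_semicomplete e)
    (e_nboc : ~ contains_induced_blocking_odd_cycle e) :
  BE_diperfect e.
Proof.
have e_ntt := no_blocking_transitive_triangle e_irr e_nboc.
move=> A S [stS maxS].
have irrA : irreflexive (induced e A) by move=> x; apply: e_irr.
have alosA : arc_locally_out_semicomplete (induced e A).
  move=> u v x y uv ux vy.
  by case: (e_alos _ _ _ _ uv ux vy) => [|/val_inj]; [left | right].
have nttA : no_transitive_triangle (induced e A).
  by move=> x y z; apply: e_ntt.
have [|||P [dip cov one ends]] := @exists_BE_partition _ _ irrA alosA nttA setT S.
- exact: subsetT.
- exact/stablebP.
- by apply/alpha_leP => S' /stablebP stS' _; apply: maxS.
exists P; split=> //; split; first by move=> p /dip[].
by move=> v; apply: cov.
Qed.
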